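(* Let $p\in[2,3)$, $\gamma\in(0,1]$ with $2+\gamma>p$, let $U,V$ be Banach spaces, $\mathbf x$ a $p$-rough path on $[0,T]$ with values in $U$ controlled by $\omega$, and $\varpi(\tau)=\tau^{(2+\gamma)/p}$. For $f:V\to L(U,V)$ differentiable let $$\phi_{t,s}(a):=a+f(a)\mathbf x^{(1)}_{s,t}+\mathrm df(a)\cdot f(a)\,\mathbf x^{(2)}_{s,t},\qquad a\in V,\ 0\le s\le t\le T.$$ If $f$ is of class $\mathcal C^{2+\gamma}_b(V,L(U,V))$, then $\phi^\pi$ converges, as the mesh of the partition $\pi$ of $[0,T]$ goes to $0$, to a unique Lipschitz flow $\psi$. Moreover, if $\chi$ is an almost flow in the galaxy containing $\phi$, then $\chi^\pi$ converges to $\psi$. Besides, there exists a unique manifold of solutions to $\mathrm dy=\phi_{\mathrm dt}(y)$, and it is Lipschitz.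
   Context: Notation. $\omega$ is a control on $[0,T]$: $\omega_{s,t}\ge0$ for $0\le s\le t\le T$, super-additive ($\omega_{r,s}+\omega_{s,t}\le\omega_{r,t}$), continuous near the diagonal, $\omega_{s,s}=0$. $\|g\|_\infty$ is the sup norm. $L(U,V)$ is the space of continuous linear maps; $\mathcal C_b^{r+\gamma}$ denotes bounded continuous functions with bounded Fréchet derivatives up to order $r$, the $r$-th one being $\gamma$-Hölder continuous (Lipschitz if $\gamma=1$). A $p$-rough path ($2\le p<3$) controlled by $\omega$: $\mathbf x^{(1)}_{s,t}\in U$, $\mathbf x^{(2)}_{s,t}\in U^{\otimes2}$ with $\mathbf x^{(1)}_{r,t}=\mathbf x^{(1)}_{r,s}+\mathbf x^{(1)}_{s,t}$, $\mathbf x^{(2)}_{r,t}=\mathbf x^{(2)}_{r,s}+\mathbf x^{(2)}_{s,t}+\mathbf x^{(1)}_{r,s}\otimes\mathbf x^{(1)}_{s,t}$ for $r\le s\le t$, and $\sup_{s<t}|\mathbf x^{(k)}_{s,t}|/\omega_{s,t}^{k/p}<\infty$, $k=1,2$. $\mathrm df(a)\cdot f(a)\in L(U^{\otimes2},V)$ is the linear map determined by $u\otimes v\mapsto[\mathrm df(a)(f(a)u)]v$ ($U^{\otimes 2}$ carries a tensor norm, e.g. the projective one, for which bounded bilinear maps extend to bounded linear maps). Almost flow (with respect to $\omega,\varpi,\gamma$). A family of continuous maps $\chi_{t,s}:V\to V$, $0\le s\le t\le T$, for which there are a non-decreasing function $\delta:\mathbb R_+\to\mathbb R_+$ with $\lim_{T'\to0}\delta_{T'}=0$,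 a constant $M\ge0$ and a continuous increasing $\eta:[0,\omega_{0,T}]\to\mathbb R_+$ with $\eta(\omega_{s,t})\varpi(\omega_{s,t})^\gamma\le\delta_{T'}\varpi(\omega_{s,t})$ for $0\le s\le t\le T'$, such that for every $T'\in(0,T]$, all $0\le r\le s\le t\le T'$, $a,b\in V$: $\chi_{t,t}=\mathrm{id}$; $\|\chi_{t,s}-\mathrm{id}\|_\infty\le\delta_{T'}$; $|\chi_{t,s}(b)-\chi_{t,s}(a)|\le(1+\delta_{T'})|b-a|+\eta(\omega_{s,t})|b-a|^\gamma$; $\|\chi_{t,s}\circ\chi_{s,r}-\chi_{t,r}\|_\infty\le M\varpi(\omega_{r,t})$. Iterated product. For a partition $\pi$ of $[0,T]$ and $s\le t$, if $t_i<\dots<t_j$ are the points of $\pi$ in $[s,t]$, $\phi^\pi_{t,s}:=\phi_{t,t_j}\circ\phi_{t_j,t_{j-1}}\circ\dots\circ\phi_{t_{i+1},t_i}\circ\phi_{t_i,s}$; if there are none, $\phi^\pi_{t,s}:=\phi_{t,s}$; likewise for $\chi^\pi$. Convergence of $\phi^\pi$ to $\psi$ means $\phi^\pi_{t,s}(a)\to\psi_{t,s}(a)$ for all $s\le t$ and $a\in V$ as the mesh tends to $0$. Galaxy. Two families of continuous maps indexed by $0\le s\le t\le T$ are in the same galaxy if the $\|\cdot\|_\infty$ norm of their difference at $(s,t)$ is at most $C'\varpi(\omega_{s,t})$ for all $s\le t$ and some constant $C'$. Flow. A family of maps $\psi_{t,s}:V\to V$, $s,t\in[0,T]$, with $\psi_{t,t}=\mathrm{id}$,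 such that each $\psi_{t,s}$ with $s\le t$ is invertible with inverse $\psi_{s,t}$, and $\psi_{t,s}\circ\psi_{s,r}=\psi_{t,r}$ for all $r,s,t\in[0,T]$ with $r\le s\le t$ or $r\ge s\ge t$. It is Lipschitz if the $\psi_{t,s}$, $s\le t$, are Lipschitz with uniformly bounded constants. Manifold of solutions to $\mathrm dy=\phi_{\mathrm dt}(y)$. A family of paths $\{y_{r\curvearrowright\cdot}(a)\}_{r\in[0,T],a\in V}$, $y_{r\curvearrowright\cdot}(a):[r,T]\to V$, with $y_{r\curvearrowright r}(a)=a$ such that for each $(r,a)$ there is a constant $C$ with $|y_{r\curvearrowright t}(a)-\phi_{t,s}(y_{r\curvearrowright s}(a))|\le C\varpi(\omega_{s,t})$ for all $r\le s\le t\le T$. It is Lipschitz if $a\mapsto y_{r\curvearrowright\cdot}(a)$ is uniformly (in $r$) Lipschitz from $V$ to $(\mathcal C([r,T],V),\|\cdot\|_\infty)$. *)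

(* Defs.v *)
From HB Require Import structures.
From mathcomp Require Import all_boot all_order all_algebra.
From mathcomp Require Import all_classical all_reals all_analysis.

Set Implicit Arguments.
Unset Strict Implicit.
Unset Printing Implicit Defensive.

Import Order.TTheory GRing.Theory Num.Theory.
Import numFieldNormedType.Exports.

Local Open Scope classical_set_scope.
Local Open Scope ring_scope.

(** * The normed space [clin U V] of continuous linear maps *)

Section ContinuousLinear.
Context {R : realType} {U V : normedModType R}.

Definition clin_pred : {pred U -> V} :=
  fun g => `[< linear g /\ continuous g >].

Record clin := CLin { clin_fun :> U -> V ; clin_funP : clin_fun \in clin_pred }.

HB.instance Definition _ := [isSub for clin_fun].
HB.instance Definition _ := [Choice of clin by <:].

Fact clin_submod_closed : submod_closed clin_pred.
Proof.
split=> [|k g h].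
  apply/asboolP; split; first by move=> k u v /=; rewrite scaler0 addr0.
  by move=> u; exact: cvg_cst.
move=> /asboolP[lg cg] /asboolP[lh ch]; apply/asboolP; split.
  move=> l u v; rewrite !fctE lg lh !scalerDr !scalerA mulrC.
  by rewrite addrACA.
move=> u; apply: (@cvgD _ _ _ _ _ (fun x => k *: g x) h); last exact: ch.
apply: cvgZl_tmp; exact: cg.
Qed.

HB.instance Definition _ :=
  GRing.isSubmodClosed.Build R (U -> V) clin_pred clin_submod_closed.
HB.instance Definition _ := [SubChoice_isSubLmodule of clin by <:].

Fact clin_is_linear (g : clin) : linear g.
Proof. by case: g => g /= /asboolP[]. Qed.

HB.instance Definition _ (g : clin) :=
  GRing.isLinear.Build R U V *:%R (clin_fun g) (clin_is_linear g).

Fact clin_continuous (g : clin) : continuous g.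
Proof. by case: g => g /= /asboolP[]. Qed.

Definition opnorm (g : clin) : R := sup [set `|g u| | u in [set u | `|u| <= 1]].

Local Notation unit_values g := [set `|g u| | u in [set u | `|u| <= 1]].

Fact unit_values0 (g : clin) : unit_values g 0.
Proof. by exists 0 => /=; rewrite ?linear0 normr0 ?ler01. Qed.

Fact has_sup_unit_values (g : clin) : has_sup (unit_values g).
Proof.
split; first by exists 0; exact: unit_values0.
have := @continuous_linear_bounded _ _ _ 0 g (@clin_continuous g 0).
move=> /linear_boundedP /pinfty_ex_gt0[C C0 gC]; exists C => _ [u /= u1 <-].
by rewrite (le_trans (gC u))// ler_piMr// ltW.
Qed.

Fact le_opnorm_unit (g : clin) u : `|u| <= 1 -> `|g u| <= opnorm g.
Proof.
by move=> u1; apply: sup_upper_bound; [exact: has_sup_unit_values|exists u].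
Qed.

Fact opnorm_le_unit (g : clin) C :
  (forall u, `|u| <= 1 -> `|g u| <= C) -> opnorm g <= C.
Proof.
move=> gC; apply: ge_sup; first by exists 0; exact: unit_values0.
by move=> _ [u /= u1 <-]; exact: gC.
Qed.

Lemma le_opnorm (g : clin) u : `|g u| <= opnorm g * `|u|.
Proof.
have [->|u0] := eqVneq u 0; first by rewrite linear0 !normr0 mulr0.
have nu : 0 < `|u| by rewrite normr_gt0.
have := @le_opnorm_unit g (`|u|^-1 *: u).
rewrite linearZ /= !normrZ normfV normr_id mulVf ?gt_eqF// lexx => /(_ erefl).
by rewrite ler_pdivrMl// mulrC.
Qed.

Fact opnorm_ge0 (g : clin) : 0 <= opnorm g.
Proof.
apply: le_trans (@le_opnorm_unit g 0 _); first exact: normr_ge0.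
by rewrite normr0 ler01.
Qed.

Fact opnormD (g h : clin) : opnorm (g + h) <= opnorm g + opnorm h.
Proof.
apply: opnorm_le_unit => u u1; rewrite (le_trans (ler_normD (g u) (h u)))//.
by rewrite lerD// le_opnorm_unit.
Qed.

Fact opnormZ (k : R) (g : clin) : opnorm (k *: g) = `|k| * opnorm g.
Proof.
have le_nZ l (h : clin) : opnorm (l *: h) <= `|l| * opnorm h.
  apply: opnorm_le_unit => u u1.
  rewrite [leLHS](_ : _ = `|l *: h u|)// normrZ.
  by rewrite ler_wpM2l// le_opnorm_unit.
apply/eqP; rewrite eq_le le_nZ /=.
have [->|k0] := eqVneq k 0; first by rewrite normr0 mul0r opnorm_ge0.
rewrite -ler_pdivlMl ?normr_gt0// -normfV.
by apply: le_trans (le_nZ _ _); rewrite scalerA mulVf// scale1r.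
Qed.

Fact opnorm_eq0 (g : clin) : opnorm g = 0 -> g = 0.
Proof.
move=> g0; apply/val_inj/funext => u /=; apply/eqP; rewrite -normr_le0.
by rewrite (le_trans (le_opnorm g u))// g0 mul0r.
Qed.

HB.instance Definition _ :=
  Lmodule_isNormed.Build R clin opnormD opnormZ opnorm_eq0.

Lemma clin_normE (g : clin) :
  `|g| = sup [set `|g u| | u in [set u | `|u| <= 1]].
Proof. by []. Qed.

End ContinuousLinear.
Arguments clin {R} U V.

(** * Regularity *)

Section Regularity.
Context {R : realType}.

(* [insubd] turns the linear map ['d g a] into a point of [clin V W]; the
   default value [0] is only used where ['d g a] is not continuous, hence not
   where [g] is differentiable. *)
Definition frechet {V W : normedModType R} (g : V -> W) (a : V) : clin V W :=
  insubd 0 ('d g a : V -> W).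

Lemma frechetE {V W : normedModType R} (g : V -> W) (a : V) :
  differentiable g a -> clin_fun (frechet g a) = 'd g a :> (V -> W).
Proof.
move=> dg; apply: (@insubdK _ _ (clin V W)).
by apply/asboolP; split; [exact: linearP|exact: diff_continuous].
Qed.

Definition bounded_map {V W : normedModType R} (g : V -> W) : Prop :=
  exists C : R, forall a, `|g a| <= C.

Definition holder {V W : normedModType R} (gamma : R) (g : V -> W) : Prop :=
  exists C : R, forall a b, `|g b - g a| <= C * `|b - a| `^ gamma.

(* The class of bounded continuous functions with bounded derivatives up to
   order [r], the [r]-th one being [gamma]-Hoelder. *)
Fixpoint Cb (r : nat) (gamma : R) {V W : normedModType R} (g : V -> W) : Prop :=
  [/\ bounded_map g, continuous g &
      if r is r'.+1
      then (forall a, differentiable g a) /\ Cb r' gamma (frechet g)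
      else holder gamma g].

End Regularity.

(** * Tensor square *)

Section Tensor.
Context {R : realType} {U W : normedModType R}.

Definition bilinear_map {E : normedModType R} (B : U -> U -> E) : Prop :=
  (forall u, linear (B u)) /\ (forall v, linear (B ^~ v)).

(* [W], with [tens u v] for the tensor product of [u] and [v], is a tensor
   square of [U] (algebraic, or completed), normed by a tensor norm for which
   bounded bilinear maps extend to bounded linear maps: for the projective norm
   the last clause holds with [K = 1]. The span of the elementary tensors being
   dense, the extension is unique. *)
Record tensor_square (tens : U -> U -> W) : Prop := TensorSquare {
  tens_bilinear : bilinear_map tens ;
  tens_norm : forall u v, `|tens u v| <= `|u| * `|v| ;
  tens_dense : closure [set w | exists n (u v : 'I_n -> U),
                          w = \sum_(i < n) tens (u i) (v i)] = setT ;
  tens_extend : exists K : R, forall (E : completeNormedModType R)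
      (B : U -> U -> E) (C : R),
    bilinear_map B -> 0 <= C -> (forall u v, `|B u v| <= C * `|u| * `|v|) ->
    exists2 L : clin W E, (forall u v, L (tens u v) = B u v) & `|L| <= K * C }.

(* The linear map determined by its values [B u v] on the [tens u v]. *)
Definition tensor_lift {E : normedModType R} (tens : U -> U -> W)
    (B : U -> U -> E) : clin W E :=
  get [set L : clin W E | forall u v, L (tens u v) = B u v].

End Tensor.

(** * Controls and rough paths *)

Section RoughPath.
Context {R : realType}.
Implicit Types (T p gamma r s t : R) (omega : R -> R -> R) (varpi : R -> R).

(* Continuity near the diagonal is taken as continuity at each diagonal point,
   relatively to the simplex [0 <= s <= t <= T]. *)
Record control T omega : Prop := Control {
  control_ge0 : forall s t, 0 <= s -> s <= t -> t <= T -> 0 <= omega s t ;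
  control_superadd : forall r s t, 0 <= r -> r <= s -> s <= t -> t <= T ->
    omega r s + omega s t <= omega r t ;
  control_cvg_diag : forall s, 0 <= s <= T ->
    omega z.1 z.2 @[z --> within [set z : R * R | 0 <= z.1 <= z.2 /\ z.2 <= T]
                            (nbhs ((s, s) : R * R))] --> (0 : R) ;
  control_diag : forall s, 0 <= s <= T -> omega s s = 0 }.

Record rough_path {U W : normedModType R} (tens : U -> U -> W) T p omega
    (x1 : R -> R -> U) (x2 : R -> R -> W) : Prop := RoughPath {
  rough_path_add : forall r s t, 0 <= r -> r <= s -> s <= t -> t <= T ->
    x1 r t = x1 r s + x1 s t ;
  rough_path_chen : forall r s t, 0 <= r -> r <= s -> s <= t -> t <= T ->
    x2 r t = x2 r s + x2 s t + tens (x1 r s) (x1 s t) ;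
  rough_path_bound1 : exists C : R, forall s t, 0 <= s -> s < t -> t <= T ->
    `|x1 s t| <= C * omega s t `^ (1 / p) ;
  rough_path_bound2 : exists C : R, forall s t, 0 <= s -> s < t -> t <= T ->
    `|x2 s t| <= C * omega s t `^ (2 / p) }.

(* Two-parameter families of maps of [V] are written [phi t s a], the final
   time coming first. *)
Definition rough_step {U V W : normedModType R} (tens : U -> U -> W)
    (x1 : R -> R -> U) (x2 : R -> R -> W) (f : V -> clin U V)
    (t s : R) (a : V) : V :=
  a + f a (x1 s t) +
  tensor_lift tens (fun u v => frechet f a (f a u) v) (x2 s t).

End RoughPath.

(** * Almost flows, flows and manifolds of solutions *)

Section Flows.
Context {R : realType} {V : normedModType R}.
Implicit Types (T r s t x e : R) (omega : R -> R -> R) (varpi : R -> R)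
  (phi psi chi : R -> R -> V -> V).

(* [eta] is only required to be increasing in the wide sense. *)
Definition almost_flow T omega varpi (gamma : R) chi : Prop :=
  (forall s t, 0 <= s -> s <= t -> t <= T -> continuous (chi t s)) /\
  exists (delta : R -> R) (M : R) (eta : R -> R),
  [/\ [/\ (forall x, 0 <= x -> 0 <= delta x),
          (forall x y : R, 0 <= x -> x <= y -> delta x <= delta y) &
          delta x @[x --> (0 : R)^'+] --> (0 : R)],
      0 <= M,
      [/\ (forall x, 0 <= x <= omega 0 T -> 0 <= eta x),
          (forall x y : R, 0 <= x -> x <= y -> y <= omega 0 T -> eta x <= eta y) &
          {within `[0, omega 0 T], continuous eta}] &
      forall T' : R, 0 < T' -> T' <= T ->
      [/\ forall s t, 0 <= s -> s <= t -> t <= T' ->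
            eta (omega s t) * varpi (omega s t) `^ gamma <=
            delta T' * varpi (omega s t),
          forall t a, 0 <= t <= T' -> chi t t a = a,
          forall s t a, 0 <= s -> s <= t -> t <= T' ->
            `|chi t s a - a| <= delta T',
          forall s t a b, 0 <= s -> s <= t -> t <= T' ->
            `|chi t s b - chi t s a| <=
            (1 + delta T') * `|b - a| + eta (omega s t) * `|b - a| `^ gamma &
          forall r s t a, 0 <= r -> r <= s -> s <= t -> t <= T' ->
            `|chi t s (chi s r a) - chi t r a| <= M * varpi (omega r t)]].

Definition same_galaxy T omega varpi chi phi : Prop :=
  exists C : R, forall s t a, 0 <= s -> s <= t -> t <= T ->
    `|chi t s a - phi t s a| <= C * varpi (omega s t).

(* [itv_partition 0 T pi] says that [0 :: pi] lists in increasing order the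
   points of a partition of [[0, T]]. *)
Definition mesh (pi : seq R) : R :=
  \big[Num.max/0]_(i < size pi) (pi`_i - (0 :: pi)`_i).

(* [chain phi t s [:: u_1; ...; u_k]] is the composition
   [phi t u_k \o ... \o phi u_2 u_1 \o phi u_1 s]. *)
Fixpoint chain phi (t s : R) (l : seq R) (a : V) : V :=
  if l is u :: l' then chain phi t u l' (phi u s a) else phi t s a.

Definition iterated_product phi (pi : seq R) (t s : R) : V -> V :=
  chain phi t s [seq u <- 0 :: pi | s <= u <= t].

Definition product_cvg T phi psi : Prop :=
  forall s t a, 0 <= s -> s <= t -> t <= T ->
  forall e, 0 < e -> exists2 d, 0 < d & forall pi : seq R,
    itv_partition 0 T pi -> mesh pi < d ->
    `|iterated_product phi pi t s a - psi t s a| < e.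

Record flow T psi : Prop := Flow {
  flow_id : forall t a, 0 <= t <= T -> psi t t a = a ;
  flow_inv : forall s t, 0 <= s -> s <= t -> t <= T ->
    cancel (psi t s) (psi s t) /\ cancel (psi s t) (psi t s) ;
  flow_comp : forall r s t a, 0 <= r <= T -> 0 <= s <= T -> 0 <= t <= T ->
    (r <= s <= t) || (t <= s <= r) -> psi t s (psi s r a) = psi t r a }.

Definition lipschitz_flow T psi : Prop :=
  flow T psi /\
  exists K : R, forall s t a b, 0 <= s -> s <= t -> t <= T ->
    `|psi t s b - psi t s a| <= K * `|b - a|.

(* [y r a t] is the value at time [t] of the path started from [a] at time
   [r]; only [0 <= r <= t <= T] matters. *)
Definition solution_manifold T omega varpi phi (y : R -> V -> R -> V) : Prop :=
  forall r a, 0 <= r <= T ->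
    y r a r = a /\
    exists C : R, forall s t, r <= s -> s <= t -> t <= T ->
      `|y r a t - phi t s (y r a s)| <= C * varpi (omega s t).

Definition lipschitz_manifold T (y : R -> V -> R -> V) : Prop :=
  (forall r a, 0 <= r <= T -> {within `[r, T], continuous (y r a)}) /\
  exists K : R, forall r a b t, 0 <= r -> r <= t -> t <= T ->
    `|y r b t - y r a t| <= K * `|b - a|.

End Flows.

(* Main.v *)
Require Import Defs.
From mathcomp Require Import all_boot all_order all_algebra.
From mathcomp Require Import all_classical all_reals all_analysis.
From mathcomp Require Import ring lra zify.

Set Implicit Arguments.
Unset Strict Implicit.
Unset Printing Implicit Defensive.

Import Order.TTheory GRing.Theory Num.Theory.
Import numFieldNormedType.Exports.

Local Open Scope classical_set_scope.
Local Open Scope ring_scope.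

(** The theorem compares sequences produced by the steps [phi t s]. Put
    [alpha = 1 / p] and [theta = (2 + gamma) / p]. The hypothesis
    [p < 2 + gamma] says that [theta > 1]; as [omega] is super-additive, errors
    of size [omega s t `^ theta] then have a negligible sum along a fine
    partition.

    The properties of [phi] that matter are the fields of [stable_scheme], which
    [rough_step_stable] establishes. Increments and their Lipschitz constants
    are of order [omega `^ alpha]; two steps in place of one make an error of
    order [omega `^ theta]; and, when the starting points vary, this error varies
    by at most [omega `^ theta] times the variation of the points (up to a term
    that can be absorbed). The last property is a bound on second differences:
    it is there that the Hoelder continuity of the second derivative of [f] is
    used, through [second_difference_le] and [taylor_difference_le]. It is needed
    because the Lipschitz constants [1 + C * omega `^ alpha] of the steps cannot
    be multiplied along a fine partition, [omega `^ alpha] not being summable.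

    The discrete sewing lemma [sewing] is applied twice. For a sequence [Y] with
    small errors at each step, it bounds [Y j - phi (g j) (g i) (Y i)] for all
    pairs of times ([one_step_to_all]). For two such sequences it bounds the
    difference of these quantities, linearly in the distance of the sequences;
    hence two sequences stay as close as their initial values and their one-step
    errors are ([stability]).

    All the rest follows from this comparison. The products of a family in the
    galaxy of [phi] along a fine grid are close to every path that solves the
    equation up to [omega `^ theta] ([product_close]). Applied to a common
    refinement of two grids, this is a Cauchy property, so the products of [phi]
    converge; the limit is Lipschitz, satisfies the flow relation, and its orbits
    solve the equation ([limit_comp], [limit_solution]). Applied to the orbits of
    the limit, it gives the convergence for the other families of the galaxy;
    applied to an arbitrary solution, the uniqueness ([limit_unique]). Over a
    short interval the limit differs from the identity by a map with Lipschitz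
    constant [1 / 2], and is therefore invertible by the Banach fixed point
    theorem ([limit_bijective]). *)

(** * Two decision procedures *)

(** [lia] on the natural-number hypotheses alone, as the real-valued ones slow it
    down. *)
Ltac nlia :=
  repeat match goal with
  | H : is_true (leq _ _) |- _ => revert H
  | H : is_true (andb (leq _ _) (leq _ _)) |- _ => revert H
  | H : @eq nat _ _ |- _ => revert H
  | H : is_true (negb (@eq_op Datatypes_nat__canonical__eqtype_Equality _ _)) |- _ => revert H
  end; clear; intros; lia.

Section AbelianIdentities.
Context {V : zmodType}.

Inductive zexpr := ZVar of nat | ZZero | ZAdd of zexpr & zexpr | ZOpp of zexpr.

Fixpoint zeval (env : seq V) e : V :=
  match e with
  | ZVar i => env`_i
  | ZZero => 0
  | ZAdd a b => zeval env a + zeval env b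
  | ZOpp a => - zeval env a
  end.

Fixpoint zbound (n : nat) e : bool :=
  match e with
  | ZVar i => (i < n)%N
  | ZZero => true
  | ZAdd a b => zbound n a && zbound n b
  | ZOpp a => zbound n a
  end.

(** The coefficient of the [i]-th atom is [zcount false e i - zcount true e i]:
    with two counts, the computations stay within the natural numbers. *)
Fixpoint zcount (neg : bool) e (i : nat) : nat :=
  match e with
  | ZVar j => (~~ neg && (i == j)) : nat
  | ZZero => 0
  | ZAdd a b => (zcount neg a i + zcount neg b i)%N
  | ZOpp a => zcount (~~ neg) a i
  end.

Lemma zevalE n env e : zbound n e ->
  zeval env e =
    \sum_(i < n) (env`_i *+ zcount false e i - env`_i *+ zcount true e i).
Proof.
elim: e => [j /= jn|/= _|a IHa b IHb /= /andP[/IHa -> /IHb ->]|a IHa /= /IHa ->].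
- rewrite (bigD1 (Ordinal jn)) //= eqxx mulr0n subr0 mulr1n big1 ?addr0 // => i ij.
  rewrite (_ : nat_of_ord i == j = false) ?mulr0n ?subr0 //.
  by apply: contraNF ij => /eqP ij; apply/eqP/val_inj.
- by rewrite big1 // => i _; rewrite !mulr0n subr0.
- rewrite -big_split /=; apply: eq_bigr => i _.
  by rewrite !mulrnDr opprD addrACA.
- by rewrite -sumrN; apply: eq_bigr => i _; rewrite opprB.
Qed.

Lemma zeval_eq n env a b : [&& zbound n a, zbound n b &
    all (fun i => zcount false a i + zcount true b i ==
                  zcount false b i + zcount true a i)%N (iota 0 n)] ->
  zeval env a = zeval env b.
Proof.
move=> /and3P[na nb /allP ab]; rewrite (zevalE env na) (zevalE env nb).
apply: eq_bigr => i _; apply/eqP.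
rewrite subr_eq addrAC eq_sym subr_eq -!mulrnDr eq_sym.
have : (i : nat) \in iota 0 n by rewrite mem_iota add0n ltn_ord.
by move=> /ab /eqP ->.
Qed.

End AbelianIdentities.

(* A syntactic comparison, conversion being slow on unequal atoms; but scalings
   may come with different, convertible, module structures. *)
Ltac zsame e x :=
  first [ constr_eq e x
        | lazymatch e with GRing.scale ?k ?a =>
            lazymatch x with GRing.scale ?k' ?b => constr_eq k k'; zsame a b end
          end ].

Ltac zatoms e l :=
  match e with
  | GRing.add ?a ?b => let l := zatoms a l in zatoms b l
  | GRing.opp ?a => zatoms a l
  | GRing.zero => l
  | _ => let rec mem l0 := match l0 with
           | nil => constr:(cons e l)
           | cons ?x _ => let _ := match tt with _ => zsame e x end in l
           | cons _ ?l1 => mem l1 end in mem l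
  end.

Ltac zreify e l :=
  match e with
  | GRing.add ?a ?b =>
    let a := zreify a l in let b := zreify b l in constr:(ZAdd a b)
  | GRing.opp ?a => let a := zreify a l in constr:(ZOpp a)
  | GRing.zero => constr:(ZZero)
  | _ => let rec idx l0 := match l0 with
           | cons ?x _ => let _ := match tt with _ => zsame e x end in constr:(O)
           | cons _ ?l1 => let n := idx l1 in constr:(S n) end in
         let n := idx l in constr:(ZVar n)
  end.

Ltac zsize l :=
  match l with
  | nil => constr:(O)
  | cons _ ?l1 => let n := zsize l1 in constr:(S n)
  end.

(** Decides the identities that hold in every abelian group, by comparing the
    coefficients of the atoms. *)
Ltac abelian :=
  match goal with |- @eq ?T ?a ?b =>
    let T := eval hnf in T in
    let l := zatoms a (@nil T) in let l := zatoms b l in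
    let ra := zreify a l in let rb := zreify b l in
    let n := zsize l in
    let H := fresh in
    pose proof (@zeval_eq _ n l ra rb ltac:(vm_compute; reflexivity)) as H;
    cbv beta iota delta [zeval nth] in H; exact H
  end.

(** * The discrete sewing lemma *)

Section Discrete.
Context {R : realType}.

(** What a control leaves on a finite grid of times: [w i j] is its value on the
    interval between the grid times of indices [i] and [j]. *)
Definition dcontrol (w : nat -> nat -> R) (m n : nat) : Prop :=
  [/\ forall i j, (m <= i)%N -> (i <= j)%N -> (j <= n)%N -> 0 <= w i j,
      forall i, (m <= i)%N -> (i <= n)%N -> w i i = 0 &
      forall i j k, (m <= i)%N -> (i <= j)%N -> (j <= k)%N -> (k <= n)%N ->
        w i j + w j k <= w i k].

Lemma dcontrol_sub w m n m' n' :
  dcontrol w m n -> (m <= m')%N -> (n' <= n)%N -> dcontrol w m' n'.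
Proof.
move=> [w0 wd ws] mm nn; split => *; [apply: w0|apply: wd|apply: ws]; nlia.
Qed.

Lemma dcontrol_le w m n i j k l : dcontrol w m n ->
  (m <= i)%N -> (i <= j)%N -> (j <= k)%N -> (k <= l)%N -> (l <= n)%N ->
  w j k <= w i l.
Proof.
move=> [w0 wd ws] mi ij jk kl ln.
have := ws i j l; have := ws j k l; have := w0 i j; have := w0 k l.
move=> /(_ ltac:(nlia) ltac:(nlia) ltac:(nlia)) ? /(_ ltac:(nlia) ltac:(nlia) ltac:(nlia)) ?.
move=> /(_ ltac:(nlia) ltac:(nlia) ltac:(nlia) ltac:(nlia)) ?.
move=> /(_ ltac:(nlia) ltac:(nlia) ltac:(nlia) ltac:(nlia)) ?.
lra.
Qed.

(** By super-additivity, the step from [s] to [s.+1] leaves at most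
    [w m n - a] on its right. With [a = w m n / 2], both sides of the step are
    thus at most half of the whole, which is Davie's way to cut an interval. *)
Lemma dcontrol_cut w m n (a : R) : dcontrol w m n -> (m < n)%N -> 0 <= a ->
  exists s, [/\ (m <= s)%N, (s < n)%N, w m s <= a &
    s.+1 = n \/ a < w m s.+1].
Proof.
move=> [w0 wd ws] mn a0.
pose P s := [&& (m <= s)%N, (s < n)%N & w m s <= a].
have exP : exists s, P s by exists m; rewrite /P leqnn mn wd// ltnW.
have bP s : P s -> (s <= n)%N by move=> /and3P[_ /ltnW].
case: (ex_maxnP exP bP) => s /and3P[ms sn wsa] smax; exists s; split => //.
have [->|sn'] := eqVneq s.+1 n; first by left.
right; rewrite ltNge; apply/negP => le.
have /smax : P s.+1 by rewrite /P le; apply/and3P; split => //; nlia.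
by rewrite ltnn.
Qed.

(** An interval is cut at the step of [dcontrol_cut] where the control is
    halved. The bounds for the two sides then add up to at most
    [(2 + d) / 2 `^ theta] times the bound for the whole; since [theta > 1], this
    factor is less than one when [d] is small, and the geometric gain absorbs the
    error terms. *)
Lemma sewing (theta : R) : 1 < theta -> exists d c : R, [/\ 0 < d, 0 < c &
  forall (w E : nat -> nat -> R) (A M : R) m n, dcontrol w m n ->
  0 <= A -> 0 <= M ->
  (forall i, (m <= i)%N -> (i <= n)%N -> E i i = 0) ->
  (forall i, (m <= i)%N -> (i < n)%N -> E i i.+1 <= A * w i i.+1 `^ theta) ->
  (forall i j k, (m <= i)%N -> (i <= j)%N -> (j <= k)%N -> (k <= n)%N ->
    E i k <= (1 + d) * E i j + E j k + M * w i k `^ theta) ->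
  (m <= n)%N -> E m n <= c * (A + M) * w m n `^ theta].
Proof.
move=> theta1; set h : R := 2 `^ theta.
have h2 : 2 < h.
  rewrite /h -[ltLHS](powRr1 (ler0n R 2)) /powR pnatr_eq0 /= ltr_expR.
  by rewrite ltr_pM2r // ln_gt0 // ltr1n.
(* [d] makes the factor [q = (2 + d) / h] equal to the mean of [2 / h] and 1. *)
pose d := (h - 2) / 2; pose q := (2 + d) / h.
have d0 : 0 < d by rewrite /d; lra.
have h0 : 0 < h by lra.
have q1 : q < 1 by rewrite /q ltr_pdivrMr // /d; lra.
pose c := (3 + d) / (1 - q).
have c0 : 0 < c by rewrite divr_gt0; lra.
have cE : c * q + (3 + d) = c.
  by rewrite /c -[X in _ + X](@divfK _ (1 - q)) //; [ring|apply/eqP; lra].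
exists d, c; split => // w E A M m n wc A0 M0 E0 E1 ES mn.
have cAM0 : 0 <= c * (A + M) by rewrite mulr_ge0 ?addr_ge0 // ltW.
have [k nk] : exists k, (n - m <= k)%N by exists (n - m)%N.
elim: k m n wc E0 E1 ES mn nk => [|N IH] m n wc E0 E1 ES mn nk.
  have -> : n = m by nlia.
  by rewrite E0 // mulr_ge0 ?powR_ge0.
have [wge0 wd ws] := wc.
have [mn_eq|m_neq_n] := eqVneq m n.
  by rewrite -mn_eq E0 // mulr_ge0 ?powR_ge0.
have m_lt_n : (m < n)%N by nlia.
set W := w m n; have W0 : 0 <= W by apply: wge0.
have [|s [ms sn wms wms1]] := dcontrol_cut (a := W / 2) wc m_lt_n.
  by rewrite divr_ge0.
have wsn : w s.+1 n <= W / 2.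
  case: wms1 => [->|lt]; first by rewrite wd // divr_ge0.
  have := ws m s.+1 n (leqnn m) (leqW ms) sn (leqnn n); rewrite -/W; lra.
have half x : 0 <= x -> x <= W / 2 -> x `^ theta <= W `^ theta / h.
  move=> x0 xW; rewrite ler_pdivlMr // -powRM //.
  by apply: ge0_ler_powR; rewrite ?nnegrE ?mulr_ge0 //; lra.
have wss : w s s.+1 <= W by apply: (dcontrol_le wc); nlia.
have B0 : 0 <= A + M by lra.
have sub i j : (m <= i)%N -> (i <= j)%N -> (j <= n)%N -> (j - i <= N)%N ->
    w i j <= W / 2 -> E i j <= c * (A + M) * (W `^ theta / h).
  move=> mi ij jn ijN wij; apply: (@le_trans _ _ (c * (A + M) * w i j `^ theta)).
    apply: (IH i j (dcontrol_sub wc mi jn)) => //.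
    - by move=> l *; apply: E0; nlia.
    - by move=> l *; apply: E1; nlia.
    - by move=> l l' l'' *; apply: ES; nlia.
  by rewrite ler_wpM2l // half // wge0.
have Ims : E m s <= c * (A + M) * (W `^ theta / h) by apply: sub => //; nlia.
have Isn : E s.+1 n <= c * (A + M) * (W `^ theta / h) by apply: sub => //; nlia.
have Iss : E s s.+1 <= A * W `^ theta.
  apply: (le_trans (E1 _ _ _)) => //; rewrite ler_wpM2l //.
  by apply: ge0_ler_powR; rewrite ?nnegrE //; [lra|apply: wge0].
have S1 := ES m s n ltac:(nlia) ltac:(nlia) ltac:(nlia) ltac:(nlia).
have S2 := ES s s.+1 n ltac:(nlia) ltac:(nlia) ltac:(nlia) ltac:(nlia).
have wsW : M * w s n `^ theta <= M * W `^ theta.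
  rewrite ler_wpM2l //; apply: ge0_ler_powR; rewrite ?nnegrE //; first lra.
    by apply: wge0; nlia.
  by apply: (dcontrol_le wc); nlia.
rewrite -/W in S1; set P := W `^ theta in Ims Isn Iss S1 wsW *.
have P0 : 0 <= P by exact: powR_ge0.
have dIms := ler_wpM2l (ltac:(lra) : 0 <= 1 + d) Ims.
have dIss := ler_wpM2l (ltac:(lra) : 0 <= 1 + d) Iss.
have -> : c * (A + M) * P = (1 + d) * (c * (A + M) * (P / h))
    + c * (A + M) * (P / h) + (3 + d) * (A + M) * P.
  by rewrite -[in LHS]cE /q; ring.
have := mulr_ge0 A0 P0; have := mulr_ge0 M0 P0.
have := mulr_ge0 (ltW d0) (mulr_ge0 M0 P0).
lra.
Qed.

(** Passage from intervals of small control to arbitrary ones. The pieces are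
    chosen greedily: one extends a piece while its control is at most [kappa],
    then makes one more step. The control to the right drops by [kappa] each time,
    hence the number [N.*2.+1] of pieces; the shortfall is made up by trivial
    pieces, so that this number depends on [N] only. *)
Lemma concat_small_pieces (w : nat -> nat -> R) (kappa : R) (Q : nat -> nat -> nat -> Prop)
    (N m n : nat) : 0 < kappa -> dcontrol w m n ->
  (forall i, (m <= i)%N -> (i < n)%N -> w i i.+1 <= kappa) ->
  (forall i j, (m <= i)%N -> (i <= j)%N -> (j <= n)%N -> w i j <= kappa ->
    Q 1%N i j) ->
  (forall a b i j k, (m <= i)%N -> (i <= j)%N -> (j <= k)%N -> (k <= n)%N ->
     Q a i j -> Q b j k -> Q (a + b)%N i k) ->
  (m <= n)%N -> w m n <= N%:R * kappa -> Q N.*2.+1 m n.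
Proof.
move=> k0; elim: N m => [|N IH] m wc st Q1 QD mn wN.
  by apply: Q1 => //; rewrite (le_trans wN) // mul0r ltW.
have [w0 wd ws] := wc.
have [wle|wgt] := lerP (w m n) kappa.
  have pad a : Q a.+1 n n.
    elim: a => [|a IHa]; first by apply: Q1; rewrite // wd // ltW.
    by rewrite -addn1; apply: QD IHa _ => //; apply: Q1; rewrite // wd // ltW.
  by rewrite doubleS -add1n; apply: QD (Q1 _ _ _ _ _ _) (pad _).
have m_lt_n : (m < n)%N.
  by rewrite ltn_neqAle mn andbT; apply/eqP => e; move: wgt; rewrite -e wd // ltNge ltW.
have [s [ms sn wms wms1]] := dcontrol_cut wc m_lt_n (ltW k0).
have wsn : w s.+1 n <= N%:R * kappa.
  case: wms1 => [->|lt]; first by rewrite wd // mulr_ge0 // ltW.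
  have := ws m s.+1 n ltac:(nlia) ltac:(nlia) ltac:(nlia) ltac:(nlia).
  by move: wN; rewrite -natr1; lra.
rewrite doubleS -[_.+3]/(1 + (1 + N.*2.+1))%N.
apply: (QD _ _ m s n) => //; first nlia; first by apply: Q1 => //; nlia.
apply: (QD _ _ s s.+1 n) => //; first by apply: Q1 => //; apply: st.
apply: IH => //; try nlia.
- by apply: dcontrol_sub wc _ _ => //; nlia.
- by move=> i *; apply: st => //; nlia.
- by move=> i j *; apply: Q1 => //; nlia.
by move=> a b i j k *; apply: (QD _ _ i j k) => //; nlia.
Qed.

Lemma powR_small (C alpha e : R) : 0 <= C -> 0 < alpha -> 0 < e ->
  exists k : R, [/\ 0 < k, k <= 1 &
    forall x, 0 <= x -> x <= k -> C * x `^ alpha <= e].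
Proof.
move=> C0 a0 e0; have C1 : 0 < C + 1 by lra.
have eC : 0 < e / (C + 1) by rewrite divr_gt0.
exists (Num.min 1 ((e / (C + 1)) `^ alpha^-1)); split.
- by rewrite lt_min ltr01 powR_gt0.
- by rewrite ge_min lexx.
move=> x x0; rewrite le_min => /andP[_ xk].
have : x `^ alpha <= e / (C + 1).
  have -> : e / (C + 1) = ((e / (C + 1)) `^ alpha^-1) `^ alpha.
    by rewrite -powRrM mulVf ?gt_eqF // powRr1 // ltW.
  by apply: ge0_ler_powR; rewrite ?nnegrE ?powR_ge0 // ltW.
rewrite ler_pdivlMr // => le; apply: le_trans le.
rewrite mulrC ler_wpM2l ?powR_ge0 //; lra.
Qed.

Lemma exists_max (u : nat -> R) m n : (m <= n)%N -> exists2 i,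
  (m <= i <= n)%N & forall j, (m <= j)%N -> (j <= n)%N -> u j <= u i.
Proof.
elim: n => [|n IH] mn.
  by exists 0%N; [rewrite mn|move=> j _; rewrite leqn0 => /eqP ->].
have [->|mn1] := eqVneq m n.+1.
  exists n.+1; first by rewrite !leqnn.
  by move=> j nj jn; have -> : j = n.+1 by nlia.
have [|i /andP[mi ni] imax] := IH.
  by nlia.
have [le|/ltW lt] := lerP (u n.+1) (u i).
  exists i; first by nlia.
  move=> j mj; rewrite leq_eqVlt => /orP[/eqP->//|jn]; exact: imax.
exists n.+1; first by nlia.
move=> j mj; rewrite leq_eqVlt => /orP[/eqP->//|jn].
by rewrite (le_trans (imax _ _ _)).
Qed.

End Discrete.

(** * Stability of sequences produced by a scheme *)

Section Scheme.
Context {R : realType} {V : normedModType R}.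

(** In [scheme_stable], [b - phi s r a] is the error made in the step from [a] to
    [b]. By [scheme_defect], replacing one step by two costs [omega r t `^ theta];
    [scheme_stable] says that this cost is, moreover, a Lipschitz function of the
    points, with a constant of the same order. It is stated for points [b] that
    are not exactly [phi s r a], at the price of the first term on the right. *)
Record stable_scheme (T : R) (omega : R -> R -> R) (alpha theta : R)
    (phi : R -> R -> V -> V) : Prop := StableScheme {
  scheme_id : forall t a, 0 <= t -> t <= T -> phi t t a = a ;
  scheme_bounded : exists C : R, forall s t a,
    0 <= s -> s <= t -> t <= T -> `|phi t s a - a| <= C ;
  scheme_increment : exists2 C : R, 0 <= C & forall s t a,
    0 <= s -> s <= t -> t <= T -> omega s t <= 1 ->
    `|phi t s a - a| <= C * omega s t `^ alpha ;
  scheme_lipschitz : exists2 C : R, 0 <= C & forall s t a b,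
    0 <= s -> s <= t -> t <= T -> omega s t <= 1 ->
    `|(phi t s a - a) - (phi t s b - b)| <= C * omega s t `^ alpha * `|a - b| ;
  scheme_defect : exists2 C : R, 0 <= C & forall r s t a,
    0 <= r -> r <= s -> s <= t -> t <= T -> omega r t <= 1 ->
    `|phi t s (phi s r a) - phi t r a| <= C * omega r t `^ theta ;
  scheme_stable : forall L : R, 0 <= L -> exists2 C : R, 0 <= C &
    forall r s t a a' b b' Z,
    0 <= r -> r <= s -> s <= t -> t <= T -> omega r t <= 1 ->
    `|b - phi s r a| <= L * omega r s `^ theta ->
    `|b' - phi s r a'| <= L * omega r s `^ theta ->
    `|a - a'| <= Z -> `|b - b'| <= Z ->
    `|(phi t s b - phi t r a - (b - phi s r a))
      - (phi t s b' - phi t r a' - (b' - phi s r a'))|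
    <= C * (omega r t `^ alpha * `|(b - phi s r a) - (b' - phi s r a')|
            + Z * omega r t `^ theta) }.

Definition grid (T : R) (g : nat -> R) (m n : nat) : Prop :=
  [/\ 0 <= g m, g n <= T &
    forall i j, (m <= i)%N -> (i <= j)%N -> (j <= n)%N -> g i <= g j].

Lemma grid_sub T g m n m' n' : grid T g m n ->
  (m <= m')%N -> (m' <= n')%N -> (n' <= n)%N -> grid T g m' n'.
Proof.
move=> [g0 gT gle] mm mn nn; split.
- by rewrite (le_trans g0) // gle //; nlia.
- by apply: le_trans gT; rewrite gle //; nlia.
by move=> i j *; apply: gle; nlia.
Qed.

Lemma grid_in T g m n i : grid T g m n -> (m <= i)%N -> (i <= n)%N ->
  0 <= g i /\ g i <= T.
Proof. by move=> gr mi ni; have [] := grid_sub gr mi (leqnn i) ni. Qed.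

Lemma grid_control T omega g m n : control T omega -> grid T g m n ->
  dcontrol (fun i j => omega (g i) (g j)) m n.
Proof.
move=> [w0 ws _ wd] gr; have [_ _ gle] := gr; split.
- move=> i j mi ij jn; have := grid_in gr mi (leq_trans ij jn).
  by have := grid_in gr (leq_trans mi ij) jn => -[? ?] [? ?]; apply: w0 => //; exact: gle.
- by move=> i mi ni; have [? ?] := grid_in gr mi ni; apply: wd; apply/andP.
- move=> i j k mi ij jk kn.
  have [? ?] : 0 <= g i /\ g i <= T by apply: (grid_in gr); nlia.
  have [? ?] : 0 <= g k /\ g k <= T by apply: (grid_in gr); nlia.
  by apply: ws => //; apply: gle; nlia.
Qed.

Context {T : R} {omega : R -> R -> R} {alpha theta : R} {phi : R -> R -> V -> V}.
Hypotheses (om : control T omega) (al0 : 0 < alpha) (th1 : 1 < theta).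
Hypothesis phiP : stable_scheme T omega alpha theta phi.

(** [`|Y j - phi (g j) (g i) (Y i)|] satisfies the hypothesis of [sewing]: the
    passage through an intermediate time costs the factor
    [1 + C * omega `^ alpha] of the step map, and its defect. *)
Lemma one_step_to_all (A : R) : 0 <= A -> exists L kappa : R,
  [/\ 0 <= L, 0 < kappa, kappa <= 1 & forall (g : nat -> R) (Y : nat -> V) m n,
    (m <= n)%N -> grid T g m n -> omega (g m) (g n) <= kappa ->
    (forall i, (m <= i)%N -> (i < n)%N ->
      `|Y i.+1 - phi (g i.+1) (g i) (Y i)| <= A * omega (g i) (g i.+1) `^ theta) ->
    `|Y n - phi (g n) (g m) (Y m)| <= L * omega (g m) (g n) `^ theta].
Proof.
move=> A0; have [d [c [d0 c0 S]]] := sewing th1.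
have [C C0 lipC] := scheme_lipschitz phiP; have [M M0 defM] := scheme_defect phiP.
have [k [k0 k1 kd]] := powR_small C0 al0 d0.
exists (c * (A + M)), k; split => //; first by rewrite mulr_ge0 ?addr_ge0 // ltW.
move=> g Y m n mn gr wk stepA.
have wc := grid_control om gr; have [w0 wd ws] := wc.
pose E i j := `|Y j - phi (g j) (g i) (Y i)|.
apply: (S (fun i j => omega (g i) (g j)) E) => //.
  by move=> i mi ni; have [? ?] := grid_in gr mi ni; rewrite /E (scheme_id phiP) // subrr normr0.
move=> i j l mi ij jl ln; rewrite /E.
have [_ _ gle] := gr.
have [gi0 giT] : 0 <= g i /\ g i <= T by apply: (grid_in gr); nlia.
have [gj0 gjT] : 0 <= g j /\ g j <= T by apply: (grid_in gr); nlia.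
have [gl0 glT] : 0 <= g l /\ g l <= T by apply: (grid_in gr); nlia.
have gij : g i <= g j by apply: gle; nlia.
have gjl : g j <= g l by apply: gle; nlia.
have wil : omega (g i) (g l) <= k.
  by apply: le_trans wk; apply: (dcontrol_le wc); nlia.
have wjl : omega (g j) (g l) <= k.
  by apply: le_trans wk; apply: (dcontrol_le wc); nlia.
have wjl0 : 0 <= omega (g j) (g l) by apply: w0; nlia.
pose b := phi (g j) (g i) (Y i).
have -> : Y l - phi (g l) (g i) (Y i) = (Y l - phi (g l) (g j) (Y j)) +
    ((Y j - b) + ((phi (g l) (g j) (Y j) - Y j) - (phi (g l) (g j) b - b))) +
    (phi (g l) (g j) b - phi (g l) (g i) (Y i)).
  by abelian.
rewrite (le_trans (ler_normD _ _)) //.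
have := defM (g i) (g j) (g l) (Y i) gi0 gij gjl glT (le_trans wil k1).
have := lipC (g j) (g l) (Y j) b gj0 gjl glT (le_trans wjl k1).
have := ler_normD (Y l - phi (g l) (g j) (Y j))
  ((Y j - b) + ((phi (g l) (g j) (Y j) - Y j) - (phi (g l) (g j) b - b))).
have := ler_normD (Y j - b) ((phi (g l) (g j) (Y j) - Y j) - (phi (g l) (g j) b - b)).
have := ler_wpM2r (normr_ge0 (Y j - b)) (kd _ wjl0 wjl).
rewrite -/b; lra.
Qed.

(** [sewing] is applied to the difference of the errors of the two sequences,
    the maximal distance [Z] of the sequences entering the bound as a constant.
    The difference of the sequences then varies by at most [Z / 4], up to a
    multiple of [rho], so that [Z] is controlled by the initial distance. An
    exponent [theta1] smaller than [theta] leaves room to express that the errors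
    of one step are small compared to [omega `^ theta1] on a fine grid. *)
Lemma stability_local (theta1 L : R) : 1 < theta1 -> theta1 <= theta -> 0 <= L ->
  exists K kappa : R,
  [/\ 0 <= K, 0 < kappa, kappa <= 1 &
  forall (g : nat -> R) (Y Y' : nat -> V) (rho : R) m n,
    (m <= n)%N -> grid T g m n -> omega (g m) (g n) <= kappa -> 0 <= rho ->
    (forall i j, (m <= i)%N -> (i <= j)%N -> (j <= n)%N ->
      `|Y j - phi (g j) (g i) (Y i)| <= L * omega (g i) (g j) `^ theta) ->
    (forall i j, (m <= i)%N -> (i <= j)%N -> (j <= n)%N ->
      `|Y' j - phi (g j) (g i) (Y' i)| <= L * omega (g i) (g j) `^ theta) ->
    (forall i, (m <= i)%N -> (i < n)%N ->
      `|(Y i.+1 - phi (g i.+1) (g i) (Y i)) -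
        (Y' i.+1 - phi (g i.+1) (g i) (Y' i))|
      <= rho * omega (g i) (g i.+1) `^ theta1) ->
    `|(Y n - Y' n) - (Y m - Y' m)| <= 1 / 2 * `|Y m - Y' m| + K * rho].
Proof.
move=> th11 th1th L0; have [d [c [d0 c0 S]]] := sewing th11.
have [C C0 lipC] := scheme_lipschitz phiP.
have [C' C'0 stab] := scheme_stable phiP L0.
have th10 : 0 < theta1 by lra.
have ov8 : (0 : R) < 1 / 8 by lra.
have [k1 [k10 k11 k1d]] := powR_small C'0 al0 d0.
have cC'0 : 0 <= c * C' by rewrite mulr_ge0 // ltW.
have [k2 [k20 _ k2d]] := powR_small cC'0 th10 ov8.
have [k3 [k30 _ k3d]] := powR_small C0 al0 ov8.
exists (2 * c), (Num.min k1 (Num.min k2 k3)); split.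
- by rewrite mulr_ge0 // ltW.
- by rewrite !lt_min k10 k20 k30.
- by rewrite ge_min k11.
move=> g Y Y' rho m n mn gr; rewrite !le_min => /and3P[wk1 wk2 wk3] rho0 DY DY' st.
have wc := grid_control om gr; have [w0 wd ws] := wc.
have [_ _ gle] := gr.
pose E i j := `|(Y j - phi (g j) (g i) (Y i)) - (Y' j - phi (g j) (g i) (Y' i))|.
have [i0 /andP[mi0 i0n] imax] := exists_max (fun i => `|Y i - Y' i|) mn.
set Z := `|Y i0 - Y' i0| in imax.
have Z0 : 0 <= Z by exact: normr_ge0.
(* The control is at most 1 here, so that the smaller exponent is the weaker bound. *)
have w1 i j : (m <= i)%N -> (i <= j)%N -> (j <= n)%N ->
    omega (g i) (g j) `^ theta <= omega (g i) (g j) `^ theta1.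
  move=> mi ij jn; have w0ij := w0 i j mi ij jn.
  have wle1 : omega (g i) (g j) <= 1.
    by apply: le_trans k11; apply: le_trans wk1; apply: (dcontrol_le wc).
  have [->|wn0] := eqVneq (omega (g i) (g j)) 0.
    by rewrite !powR0 //; apply/eqP; lra.
  by apply: ger_powR => //; rewrite lt_def wn0 w0ij.
have Emk k : (m <= k)%N -> (k <= n)%N ->
    E m k <= c * (rho + C' * Z) * omega (g m) (g k) `^ theta1.
  move=> mk kn; apply: (S (fun i j => omega (g i) (g j)) E) => //.
  - exact: dcontrol_sub wc _ kn.
  - by rewrite mulr_ge0.
  - move=> i mi ik; have [? ?] := grid_in gr mi (leq_trans ik kn).
    by rewrite /E !(scheme_id phiP) // !subrr normr0.
  - by move=> i mi ik; apply: st => //; nlia.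
  move=> i j l mi ij jl lk.
  have [gi0 giT] : 0 <= g i /\ g i <= T by apply: (grid_in gr); nlia.
  have [gl0 glT] : 0 <= g l /\ g l <= T by apply: (grid_in gr); nlia.
  have gij : g i <= g j by apply: gle; nlia.
  have gjl : g j <= g l by apply: gle; nlia.
  have wil : omega (g i) (g l) <= k1.
    by apply: le_trans wk1; apply: (dcontrol_le wc); nlia.
  have wil0 : 0 <= omega (g i) (g l) by apply: w0; nlia.
  have DYij : `|Y j - phi (g j) (g i) (Y i)| <= L * omega (g i) (g j) `^ theta.
    by apply: DY; nlia.
  have DY'ij : `|Y' j - phi (g j) (g i) (Y' i)| <= L * omega (g i) (g j) `^ theta.
    by apply: DY'; nlia.
  have Zi : `|Y i - Y' i| <= Z by apply: imax; nlia.
  have Zj : `|Y j - Y' j| <= Z by apply: imax; nlia.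
  have := stab _ _ _ _ _ _ _ _ gi0 gij gjl glT (le_trans wil k11) DYij DY'ij Zi Zj.
  set D := _ - (_ - _ - (_ - _)); move=> HD.
  have -> : E i l = `|((Y l - phi (g l) (g j) (Y j)) -
      (Y' l - phi (g l) (g j) (Y' j))) +
      ((Y j - phi (g j) (g i) (Y i)) - (Y' j - phi (g j) (g i) (Y' i))) + D|.
    by rewrite /E /D; congr (`|_|); abelian.
  apply: (le_trans (ler_normD _ _)).
  apply: (le_trans (lerD (ler_normD _ _) (lexx _))).
  rewrite -/(E j l) -/(E i j).
  move: HD; rewrite -/(E i j).
  have := k1d _ wil0 wil.
  have := ler_wpM2l (mulr_ge0 C'0 Z0) (w1 i l mi (leq_trans ij jl) (leq_trans lk kn)).
  have E0 : 0 <= E i j by exact: normr_ge0.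
  move=> h1 /(ler_wpM2r E0) h2 h3; lra.
have zk k : (m <= k)%N -> (k <= n)%N ->
    `|(Y k - Y' k) - (Y m - Y' m)| <= 1 / 4 * Z + c * rho.
  move=> mk kn; have := Emk k mk kn.
  have [gm0 gmT] : 0 <= g m /\ g m <= T by apply: (grid_in gr); nlia.
  have [gk0 gkT] : 0 <= g k /\ g k <= T by apply: (grid_in gr); nlia.
  have gmk : g m <= g k by apply: gle; nlia.
  have wmk : omega (g m) (g k) <= omega (g m) (g n).
    by apply: (dcontrol_le wc); nlia.
  have wmk0 : 0 <= omega (g m) (g k) by apply: w0; nlia.
  have wmk1 : omega (g m) (g k) <= 1 by rewrite (le_trans wmk) // (le_trans wk1).
  have := lipC _ _ (Y m) (Y' m) gm0 gmk gkT wmk1.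
  have := k2d _ wmk0 (le_trans wmk wk2); have := k3d _ wmk0 (le_trans wmk wk3).
  have : omega (g m) (g k) `^ theta1 <= 1.
    apply: (@le_trans _ _ (1 `^ theta1)); last by rewrite powR1.
    by apply: ge0_ler_powR; rewrite ?nnegrE // ltW.
  have Zm : `|Y m - Y' m| <= Z by apply: imax.
  set p1 := _ `^ theta1; set pa := _ `^ alpha => p11 h3 h2 h1 hE.
  have -> : (Y k - Y' k) - (Y m - Y' m) =
      ((Y k - phi (g k) (g m) (Y m)) - (Y' k - phi (g k) (g m) (Y' m))) +
      ((phi (g k) (g m) (Y m) - Y m) - (phi (g k) (g m) (Y' m) - Y' m)).
    by abelian.
  apply: (le_trans (ler_normD _ _)); rewrite -/(E m k).
  have Cpa0 : 0 <= C * pa by rewrite mulr_ge0 // powR_ge0.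
  have := ler_wpM2l Cpa0 Zm; have := ler_wpM2r Z0 h3; have := ler_wpM2r Z0 h2.
  have := ler_wpM2l (mulr_ge0 (ltW c0) rho0) p11.
  lra.
have := zk n mn (leqnn n).
have := zk i0 mi0 i0n; have := lerB_dist (Y i0 - Y' i0) (Y m - Y' m).
rewrite -/Z; have := mulr_ge0 (ltW c0) rho0; have := normr_ge0 (Y m - Y' m).
lra.
Qed.

(** The local estimate is iterated over boundedly many pieces of small control,
    for the quantity [`|Y j - Y' j| + rho], which is multiplied by at most
    [K + 2] over a piece. *)
Lemma stability (theta1 A : R) : 1 < theta1 -> theta1 <= theta -> 0 <= A ->
  exists K kappa : R,
  [/\ 0 <= K, 0 < kappa, kappa <= 1 &
  forall (g : nat -> R) (Y Y' : nat -> V) (rho : R) m n,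
    (m <= n)%N -> grid T g m n -> 0 <= rho ->
    (forall i, (m <= i)%N -> (i < n)%N -> omega (g i) (g i.+1) <= kappa) ->
    (forall i, (m <= i)%N -> (i < n)%N ->
      `|Y i.+1 - phi (g i.+1) (g i) (Y i)| <= A * omega (g i) (g i.+1) `^ theta) ->
    (forall i, (m <= i)%N -> (i < n)%N ->
      `|Y' i.+1 - phi (g i.+1) (g i) (Y' i)| <= A * omega (g i) (g i.+1) `^ theta) ->
    (forall i, (m <= i)%N -> (i < n)%N ->
      `|(Y i.+1 - phi (g i.+1) (g i) (Y i)) -
        (Y' i.+1 - phi (g i.+1) (g i) (Y' i))|
      <= rho * omega (g i) (g i.+1) `^ theta1) ->
    `|Y n - Y' n| <= K * (`|Y m - Y' m| + rho) /\
    (omega (g m) (g n) <= kappa ->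
     `|(Y n - Y' n) - (Y m - Y' m)| <= 1 / 2 * `|Y m - Y' m| + K * rho)].
Proof.
move=> th11 th1th A0.
have [L [kA [L0 kA0 kA1 toall]]] := one_step_to_all A0.
have [K [kB [K0 kB0 kB1 loc]]] := stability_local th11 th1th L0.
pose k := Num.min kA kB.
have k0 : 0 < k by rewrite lt_min kA0.
have kkA : k <= kA by rewrite ge_min lexx.
have kkB : k <= kB by rewrite ge_min lexx orbT.
pose N := (Num.truncn (omega 0 T / k)).+1.
pose K1 := K + 2.
have K11 : 1 <= K1 by rewrite /K1; lra.
exists (K1 ^+ (N.*2.+1)), k; split => //.
- by rewrite exprn_ge0 //; lra.
- exact: le_trans kkA kA1.
move=> g Y Y' rho m n mn gr rho0 wk sY sY' sYY'.
have wc := grid_control om gr; have [w0 wd ws] := wc.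
have local i j : (m <= i)%N -> (i <= j)%N -> (j <= n)%N ->
    omega (g i) (g j) <= k ->
    `|(Y j - Y' j) - (Y i - Y' i)| <= 1 / 2 * `|Y i - Y' i| + K * rho.
  move=> mi ij jn wij.
  have wc' := dcontrol_sub wc mi jn.
  apply: (loc g) => //; first exact: grid_sub gr mi ij jn.
  - exact: le_trans wij kkB.
  - move=> i' j' ii ij' jj; apply: (toall g) => //.
    + by apply: (grid_sub gr); nlia.
    + rewrite (le_trans _ (le_trans wij kkA)) //.
      by apply: (dcontrol_le wc'); nlia.
    + by move=> *; apply: sY; nlia.
  - move=> i' j' ii ij' jj; apply: (toall g) => //.
    + by apply: (grid_sub gr); nlia.
    + rewrite (le_trans _ (le_trans wij kkA)) //.
      by apply: (dcontrol_le wc'); nlia.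
    + by move=> *; apply: sY'; nlia.
  by move=> *; apply: sYY'; nlia.
have K_K1 : K <= K1 ^+ N.*2.+1.
  by rewrite (le_trans _ (ler_eXnr _ K11)) // /K1; lra.
split; last first.
  move=> wmn; apply: (le_trans (local m n _ _ _ wmn)) => //.
  by rewrite lerD2l ler_wpM2r.
suff : `|Y n - Y' n| + rho <= K1 ^+ N.*2.+1 * (`|Y m - Y' m| + rho) by lra.
pose Q a i j := `|Y j - Y' j| + rho <= K1 ^+ a * (`|Y i - Y' i| + rho).
apply: (@concat_small_pieces R (fun i j => omega (g i) (g j)) k Q) => //.
- move=> i j mi ij jn wij; rewrite /Q expr1 /K1.
  have := local i j mi ij jn wij; have := lerB_dist (Y j - Y' j) (Y i - Y' i).
  have := mulr_ge0 K0 (normr_ge0 (Y i - Y' i)); have := normr_ge0 (Y i - Y' i).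
  lra.
- move=> a b i j l mi ij jl ln Qij Qjl; rewrite /Q addnC exprD -mulrA.
  by apply: le_trans Qjl _; rewrite ler_wpM2l // exprn_ge0 //; lra.
have [g0 gT gle] := gr.
have [T0 wT] : 0 <= T /\ omega (g m) (g n) <= omega 0 T.
  have gmn : g m <= g n by exact: gle.
  have T0 : 0 <= T by lra.
  split=> //; have [v0 vs _ vd] := om.
  have := vs 0 (g m) T (lexx 0) g0 (le_trans gmn gT) (lexx T).
  have := vs (g m) (g n) T g0 gmn gT (lexx T).
  have := v0 0 (g m) (lexx 0) g0 (le_trans gmn gT).
  have := v0 (g n) T (le_trans g0 gmn) gT (lexx T).
  lra.
rewrite (le_trans wT) // -ler_pdivrMr // ltW //.
by rewrite /N; apply: truncnS_gt.
Qed.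

End Scheme.

(** * Second differences of regular maps *)

Section MeanValue.
Context {R : realType}.

Lemma le_clin {U W : normedModType R} (g : clin U W) u : `|g u| <= `|g| * `|u|.
Proof. exact: le_opnorm. Qed.

Lemma clinB {U W : normedModType R} (g : clin U W) u v : g (u - v) = g u - g v.
Proof. exact: linearB. Qed.

Lemma clinD {U W : normedModType R} (g : clin U W) u v : g (u + v) = g u + g v.
Proof. exact: linearD. Qed.

Lemma subclinE {U W : normedModType R} (g h : clin U W) u :
  (g - h : clin U W) u = g u - h u.
Proof. by []. Qed.

Lemma clin_difference {U W : normedModType R} (P Q P' Q' : clin U W) u u' :
  P u - Q u - (P' u' - Q' u') =
    (P - Q - (P' - Q') : clin U W) u + (P' - Q' : clin U W) (u - u').
Proof.
rewrite !subclinE !clinB.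
move: (P u) (Q u) (P' u) (Q' u) (P' u') (Q' u') => *; by abelian.
Qed.

Lemma clin_norm_le {U W : normedModType R} (g : clin U W) (C : R) : 0 <= C ->
  (forall u, `|g u| <= C * `|u|) -> `|g| <= C.
Proof.
move=> C0 gC; apply: opnorm_le_unit => u u1.
by rewrite (le_trans (gC u)) // ler_piMr.
Qed.

Lemma is_derive_near {E : normedModType R} (u : R -> E) (t : R) v (e : R) :
  is_derive t (1 : R) u v -> 0 < e ->
  exists2 d : R, 0 < d & forall s, `|s - t| < d ->
    `|u s - u t| <= (`|v| + e) * `|s - t|.
Proof.
move=> ud e0; have du : differentiable u t by apply/derivable1_diffP; case: ud.
have /eqaddoP/(_ e e0)/nbhs_ballP[d /= d0 ball_d] := diff_locally du.
exists d => // s sd.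
have /= := ball_d (s - t); rewrite -ball_normE /= sub0r normrN => /(_ sd).
have dE : 'd u t (s - t) = (s - t) *: v.
  rewrite -[X in 'd u t X]mulr1 -[_ * 1]/(_ *: _) linearZ /= -deriveE //.
  by congr (_ *: _); case: ud.
have -> : (u \o +%R^~ t - (cst (u t) + 'd u t)) (s - t) = u s - (u t + (s - t) *: v).
  by rewrite -dE -[in RHS](subrK t s) addrK.
move=> h.
have -> : u s - u t = (u s - (u t + (s - t) *: v)) + (s - t) *: v.
  by rewrite opprD addrA subrK.
rewrite (le_trans (ler_normD _ _)) // normrZ mulrDl addrC lerD //.
by rewrite mulrC.
Qed.

(** For a vector-valued curve there is no intermediate point. The supremum of the
    times up to which the bound holds, with [C + e] in place of [C], must be 1:
    [is_derive_near] shows both that the bound holds at this supremum and that it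
    would otherwise extend beyond. *)
Lemma mean_value_le {E : normedModType R} (u du : R -> E) (C : R) :
  (forall t : R, 0 <= t -> t <= 1 -> is_derive t (1 : R) u (du t)) ->
  (forall t : R, 0 <= t -> t <= 1 -> `|du t| <= C) -> `|u 1 - u 0| <= C.
Proof.
move=> ud duC; apply/ler_addgt0Pr => e e0.
have near t : 0 <= t -> t <= 1 -> exists2 d : R, 0 < d &
    forall s, `|s - t| < d -> `|u s - u t| <= (C + e) * `|s - t|.
  move=> t0 t1; have [d d0 H] := is_derive_near (ud t t0 t1) e0.
  exists d => // s /H /le_trans; apply; rewrite ler_wpM2r //.
  by rewrite lerD2r duC.
have Ce : 0 <= C + e.
  by rewrite addr_ge0 ?(ltW e0) // (le_trans _ (duC 0 _ _)) ?ler01.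
pose S : set R := [set t | [/\ 0 <= t, t <= 1 & `|u t - u 0| <= (C + e) * t]].
have S0 : S 0 by split; rewrite ?ler01 // subrr normr0 mulr0.
have Sb : has_sup S by split; [exists 0|exists 1 => t []].
have [s [subs adhs s1]] : exists s : R, [/\ forall t, S t -> t <= s,
    forall d : R, 0 < d -> exists2 t : R, S t & s - d < t & s <= 1].
  exists (sup S); split.
  - exact: sup_upper_bound.
  - by move=> d d0; have [t] := sup_adherent d0 Sb; exists t.
  - by apply: ge_sup => [|t []]; first by exists 0.
have s0 : 0 <= s by exact: subs.
have [d d0 H] := near s s0 s1.
have Ss : S s.
  split => //; have [t St0 st] := adhs d d0; have ts := subs t St0.
  have [t0 t1 St] := St0.
  have := H t; rewrite [`|t - s|]distrC ger0_norm ?subr_ge0 // => /(_ ltac:(lra)).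
  have := ler_distD (u t) (u s) (u 0); rewrite (distrC (u s) (u t)); lra.
suff sE : s = 1 by case: Ss => _ _; rewrite sE mulr1.
apply/eqP; rewrite eq_le s1 leNgt; apply/negP => lt1.
pose t := Num.min 1 (s + d / 2).
have st : s < t by rewrite /t lt_min lt1 ltrDl divr_gt0.
have t1 : t <= 1 by rewrite ge_min lexx.
have td : t <= s + d / 2 by rewrite ge_min lexx orbT.
suff : S t by move=> /subs; rewrite leNgt st.
split => //; first by lra.
have := H t; rewrite ger0_norm ?subr_ge0 ?(ltW st) // => /(_ ltac:(lra)).
have := ler_distD (u s) (u t) (u 0); case: Ss => _ _; lra.
Qed.

End MeanValue.

#[local] Opaque frechet clin_fun.

Section Differences.
Context {R : realType} {V E : normedModType R}.
Implicit Types G : V -> E.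

Lemma is_derive_line G (c z : V) (t : R) : differentiable G (c + t *: z) ->
  is_derive t (1 : R) (fun s => G (c + s *: z)) (frechet G (c + t *: z) z).
Proof.
move=> dG.
have dl : is_diff t (fun s : R => c + s *: z) (fun s : R => 0 + s *: z).
  exact: (@is_diffD _ _ _ (cst c) (fun s : R => s *: z)).
have dc : is_diff t (G \o (fun s : R => c + s *: z))
    ('d G (c + t *: z) \o (fun s : R => 0 + s *: z)).
  by apply: is_diff_comp; exact: differentiableP.
apply: DeriveDef; first by apply: diff_derivable; case: dc.
rewrite -[fun s => _]/(G \o (fun s : R => c + s *: z)) deriveE; last by case: dc.
by case: dc => _ ->; rewrite /= add0r scale1r frechetE.
Qed.

Lemma lipschitz_of_frechet G (C : R) : (forall a, differentiable G a) ->
  (forall a, `|frechet G a| <= C) -> forall a b, `|G b - G a| <= C * `|b - a|.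
Proof.
move=> dG GC a b; pose u (s : R) := G (a + s *: (b - a)).
have -> : G b - G a = u 1 - u 0.
  by rewrite /u scale1r scale0r addr0 [a + _]addrC subrK.
apply: (@mean_value_le _ _ u (fun t => frechet G (a + t *: (b - a)) (b - a))).
  by move=> t _ _; exact: is_derive_line.
move=> t _ _; apply: le_trans (le_clin _ _) _.
by rewrite ler_wpM2r.
Qed.

Lemma convex_norm_le (a b : E) (t H : R) : 0 <= t -> t <= 1 ->
  `|a| <= H -> `|b| <= H -> `|a + t *: (b - a)| <= H.
Proof.
move=> t0 t1 aH bH.
have -> : a + t *: (b - a) = (1 - t) *: a + t *: b.
  by rewrite scalerBl scale1r scalerBr; abelian.
apply: le_trans (ler_normD _ _) _; rewrite !normrZ !ger0_norm ?subr_ge0 //.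
have : (1 - t) * `|a| <= (1 - t) * H by rewrite ler_wpM2l // subr_ge0.
have : t * `|b| <= t * H by rewrite ler_wpM2l.
lra.
Qed.
End Differences.

Section SecondDifferences.
Context {R : realType} {V E : normedModType R}.
Implicit Types G : V -> E.

(** The curve joins [G b' - G a'] to [G b - G a] by moving [a'] to [a] and [b']
    to [b]. Moving along [b - a] instead would give the factor [Z `^ gamma * H],
    which is not linear in [Z]. *)
Lemma second_difference_le G (C gamma : R) : 0 <= C -> 0 <= gamma ->
  (forall a, differentiable G a) -> (forall a, `|frechet G a| <= C) ->
  (forall a b, `|frechet G b - frechet G a| <= C * `|b - a| `^ gamma) ->
  forall a b a' b' (H Z : R),
  `|b - a| <= H -> `|b' - a'| <= H -> `|a - a'| <= Z -> `|b - b'| <= Z ->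
  `|G b - G a - (G b' - G a')| <= C * (`|(b - a) - (b' - a')| + Z * H `^ gamma).
Proof.
move=> C0 g0 dG GC hG a b a' b' H Z baH ba'H aaZ bbZ.
pose u := (fun s : R => G (b' + s *: (b - b'))) - (fun s : R => G (a' + s *: (a - a'))).
pose p (s : R) := b' + s *: (b - b'); pose q (s : R) := a' + s *: (a - a').
have -> : G b - G a - (G b' - G a') = u 1 - u 0.
  rewrite /u !fctE !scale1r !scale0r !addr0 [b' + _]addrC [a' + _]addrC !subrK.
  by abelian.
apply: (@mean_value_le _ _ u
  (fun t => frechet G (p t) (b - b') - frechet G (q t) (a - a'))).
  by move=> t _ _; apply: is_deriveB; exact: is_derive_line.
move=> t t0 t1.
have -> : frechet G (p t) (b - b') - frechet G (q t) (a - a') =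
    (frechet G (p t) - frechet G (q t)) (b - b') +
    frechet G (q t) ((b - b') - (a - a')).
  by rewrite subclinE [frechet G (q t) (b - b' - _)]clinB; abelian.
have pqH : `|p t - q t| <= H.
  have -> : p t - q t = (b' - a') + t *: ((b - a) - (b' - a')).
    by rewrite /p /q !scalerBr; abelian.
  exact: convex_norm_le.
have H0 : 0 <= H by exact: le_trans baH.
apply: (le_trans (ler_normD _ _)); rewrite mulrDr addrC.
have -> : b - a - (b' - a') = b - b' - (a - a') by abelian.
apply: lerD; first by rewrite (le_trans (le_clin _ _)) // ler_wpM2r.
rewrite (le_trans (le_clin _ _)) // [Z * _]mulrC mulrA ler_pM //.
rewrite (le_trans (hG _ _)) // ler_wpM2l //.
by apply: ge0_ler_powR; rewrite ?nnegrE.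
Qed.

(** The derivative of the Taylor remainder along the segment is a difference of
    values of [frechet f], so that its variation is a second difference of
    [frechet f], for which a bound [eps] is assumed. *)
Lemma taylor_difference_le (f : V -> E) (C eps : R) a b a' b' (H Z D : R) :
  0 <= C -> (forall a, differentiable f a) ->
  (forall a b, `|frechet f b - frechet f a| <= C * `|b - a|) ->
  (forall b b', `|b - a| <= H -> `|b' - a'| <= H -> `|b - b'| <= Z ->
     `|(b - a) - (b' - a')| <= D ->
     `|frechet f b - frechet f a - (frechet f b' - frechet f a')| <= eps) ->
  `|b - a| <= H -> `|b' - a'| <= H -> `|a - a'| <= Z -> `|b - b'| <= Z ->
  `|(b - a) - (b' - a')| <= D ->
  `|(f b - f a - frechet f a (b - a)) - (f b' - f a' - frechet f a' (b' - a'))|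
    <= (eps + C * D) * H.
Proof.
move=> C0 df lipdf eps_df baH ba'H aaZ bbZ bD.
pose h := b - a; pose h' := b' - a'.
pose u := ((fun s : R => f (a + s *: h)) - (fun s : R => s *: frechet f a h))
   - ((fun s : R => f (a' + s *: h')) - (fun s : R => s *: frechet f a' h')).
have -> : (f b - f a - frechet f a (b - a)) - (f b' - f a' - frechet f a' (b' - a'))
    = u 1 - u 0.
  rewrite /u !fctE !scale1r !scale0r !addr0 /h /h' [a + _]addrC [a' + _]addrC !subrK.
  by abelian.
have H0 : 0 <= H by exact: le_trans baH.
apply: (@mean_value_le _ _ u (fun t =>
   (frechet f (a + t *: h) h - frechet f a h)
   - (frechet f (a' + t *: h') h' - frechet f a' h'))).
  move=> t _ _.
  have dl (v : E) : is_derive t (1 : R) (fun s : R => s *: v) v.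
    apply: DeriveDef; first exact: diff_derivable.
    by rewrite deriveE // diff_val /= scale1r.
  apply: is_deriveB; apply: is_deriveB; exact: is_derive_line.
move=> t t0 t1; set P := frechet f (a + t *: h); set P' := frechet f (a' + t *: h').
have -> : P h - frechet f a h - (P' h' - frechet f a' h') =
    (P - frechet f a - (P' - frechet f a')) h + (P' - frechet f a') (h - h').
  exact: clin_difference.
have th (k : V) : `|k| <= H -> `|t *: k| <= H.
  by move=> kH; rewrite normrZ ger0_norm // (le_trans _ kH) // ler_piMl.
apply: le_trans (ler_normD _ _) _; rewrite mulrDl; apply: lerD.
  rewrite (le_trans (le_clin _ _)) // ler_pM // eps_df //.
  - by rewrite [a + _]addrC addrK th.
  - by rewrite [a' + _]addrC addrK th.
  - have -> : a + t *: h - (a' + t *: h') = (a - a') + t *: ((b - b') - (a - a')).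
      rewrite /h /h' !scalerBr. by abelian.
    exact: convex_norm_le.
  have -> : a + t *: h - a - (a' + t *: h' - a') = t *: (h - h').
    by rewrite [t *: (h - h')]scalerBr; abelian.
  by rewrite normrZ ger0_norm // (le_trans _ bD) // ler_piMl.
rewrite (le_trans (le_clin _ _)) // mulrAC ler_pM //.
rewrite (le_trans (lipdf _ _)) // ler_wpM2l //.
by rewrite [a' + _]addrC addrK th.
Qed.

End SecondDifferences.

(** * The vector field and its tensor lift *)

Lemma clin_sum {R : realType} {U W : normedModType R} (g : clin U W) n
    (u : 'I_n -> U) : g (\sum_(i < n) u i) = \sum_(i < n) g (u i).
Proof. exact: linear_sum. Qed.

Section ProductDifferences.
Context {R : realType} {U V : normedModType R}.
Implicit Types (P Q : clin V (clin U V)) (g h : clin U V).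

(** The Leibniz rule for the product of [P] and [g], in the form of differences;
    the next lemma is its second-order version. *)
Lemma product_difference P Q g h u v :
  P (g u) v - Q (h u) v =
    (P - Q : clin V (clin U V)) (g u) v + Q ((g - h : clin U V) u) v.
Proof.
have -> : (P - Q : clin V (clin U V)) (g u) v = P (g u) v - Q (g u) v by [].
have -> : Q ((g - h : clin U V) u) v = Q (g u) v - Q (h u) v.
  have -> : (g - h : clin U V) u = g u - h u by [].
  by rewrite (clinB Q (g u) (h u)).
move: (P (g u) v) (Q (g u) v) (Q (h u) v) => x y z; by abelian.
Qed.

Lemma product_second_difference P Q P' Q' g h g' h' u v :
  P (g u) v - Q (h u) v - (P' (g' u) v - Q' (h' u) v) =
    (P - Q - (P' - Q') : clin V (clin U V)) (g u) v +
    (P' - Q' : clin V (clin U V)) ((g - g' : clin U V) u) v +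
    (Q - Q' : clin V (clin U V)) ((g - h : clin U V) u) v +
    Q' ((g - h - (g' - h') : clin U V) u) v.
Proof.
have E (P1 : clin V (clin U V)) (x y : V) : P1 (x - y) v = P1 x v - P1 y v.
  by rewrite (clinB P1 x y).
have -> : (P - Q - (P' - Q') : clin V (clin U V)) (g u) v =
  P (g u) v - Q (g u) v - (P' (g u) v - Q' (g u) v) by [].
have -> : (P' - Q' : clin V (clin U V)) ((g - g' : clin U V) u) v =
    (P' (g u) v - P' (g' u) v) - (Q' (g u) v - Q' (g' u) v).
  by rewrite -(E P') -(E Q').
have -> : (Q - Q' : clin V (clin U V)) ((g - h : clin U V) u) v =
    (Q (g u) v - Q (h u) v) - (Q' (g u) v - Q' (h u) v).
  by rewrite -(E Q) -(E Q').
have -> : Q' ((g - h - (g' - h') : clin U V) u) v =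
    Q' (g u) v - Q' (h u) v - (Q' (g' u) v - Q' (h' u) v).
  by rewrite -!(E Q').
move: (P (g u) v) (Q (h u) v) (P' (g' u) v) (Q' (h' u) v) (Q (g u) v) (P' (g u) v)
  (Q' (g u) v) (Q' (h u) v) (Q' (g' u) v) => *; by abelian.
Qed.

End ProductDifferences.

Section TensorLift.
Context {R : realType} {U W : normedModType R} {tens : U -> U -> W}.
Hypothesis tensP : tensor_square tens.

(** Elementary tensors span a dense subspace, so that a continuous linear map is
    determined by its values on them. *)
Lemma clin_eq_on_tensors {E : normedModType R} (g h : clin W E) :
  (forall u v, g (tens u v) = h (tens u v)) -> g = h.
Proof.
move=> gh; apply/eqP; rewrite -subr_eq0 -normr_le0; apply: clin_norm_le => // w.
rewrite mul0r; set k : clin W E := g - h.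
apply/ler_addgt0Pr => e e0; rewrite add0r.
have k1 : 0 < `|k| + 1 by rewrite ltr_wpDl.
have wcl : closure [set w | exists n (u v : 'I_n -> U),
    w = \sum_(i < n) tens (u i) (v i)] w by rewrite (tens_dense tensP).
have [|_ [[n [u [v ->]]]]] := wcl (ball w (e / (`|k| + 1))).
  by apply: nbhsx_ballx; rewrite divr_gt0.
rewrite -ball_normE /=; set s := \sum_(i < n) _ => ws.
have ks : k s = 0.
  rewrite /k subclinE /s; apply/eqP; rewrite subr_eq0; apply/eqP.
  by rewrite !clin_sum; apply: eq_bigr => i _; rewrite gh.
have -> : k w = k (w - s) by rewrite clinB ks subr0.
apply: (le_trans (le_clin _ _)).
have : `|k| * `|w - s| <= (`|k| + 1) * (e / (`|k| + 1)).
  by rewrite ler_pM // ?(ltW ws) // lerDl.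
by rewrite mulrCA divff ?mulr1 // gt_eqF.
Qed.

(** The extension of the bilinear map [g (tens u v)] has a controlled norm, and
    it can only be [g]. This turns bounds on [frechet f a (f a u) v] into bounds
    on the lifted map and on its differences. *)
Lemma tens_clin_norm_le : exists2 K : R, 0 <= K &
  forall (E : completeNormedModType R) (g : clin W E) (C : R), 0 <= C ->
  (forall u v, `|g (tens u v)| <= C * `|u| * `|v|) -> `|g| <= K * C.
Proof.
have [K extK] := tens_extend tensP; exists (Num.max 0 K).
  by rewrite le_max lexx.
move=> E g C C0 gC.
have [bl br] := tens_bilinear tensP.
have [|L Lg LK] := extK E (fun u v => g (tens u v)) C _ C0 gC.
- by split=> [u k v v'|v k u u']; rewrite (bl, br) clin_is_linear.
rewrite (clin_eq_on_tensors (g := g) (h := L)) //.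
by rewrite (le_trans LK) // ler_wpM2r // le_max lexx orbT.
Qed.

Lemma tensor_liftE {E : completeNormedModType R} (B : U -> U -> E) (C : R) :
  bilinear_map B -> 0 <= C -> (forall u v, `|B u v| <= C * `|u| * `|v|) ->
  forall u v, tensor_lift tens B (tens u v) = B u v.
Proof.
move=> Bbil C0 BC; have [K extK] := tens_extend tensP.
have [L LB _] := extK E B C Bbil C0 BC.
by apply: (@getPex _ [set L : clin W E | forall u v, L (tens u v) = B u v]); exists L.
Qed.

End TensorLift.

Section VectorField.
Context {R : realType} {U V : completeNormedModType R} {W : normedModType R}.

(** What is used of a vector field of class [2 + gamma] with [F] for its lifted
    product [df . f]. In [field_taylor] and [field2_difference], [Z] bounds the
    distance of the two pairs of points, [H] their lengths and [D] the difference
    of their increments; linearity in [Z] and [D] is the point. *)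
Record second_order_field (tens : U -> U -> W) (gamma C K : R)
    (f : V -> clin U V) (F : V -> clin W V) : Prop := SecondOrderField {
  field_bounded : forall a, `|f a| <= C ;
  field_lipschitz : forall a b, `|f b - f a| <= C * `|b - a| ;
  field_deriv_bounded : forall a, `|frechet f a| <= C ;
  field_deriv_lipschitz : forall a b, `|frechet f b - frechet f a| <= C * `|b - a| ;
  field_taylor : forall a b a' b' (H Z D : R),
    `|b - a| <= H -> `|b' - a'| <= H -> `|a - a'| <= Z -> `|b - b'| <= Z ->
    `|(b - a) - (b' - a')| <= D ->
    `|(f b - f a - frechet f a (b - a)) - (f b' - f a' - frechet f a' (b' - a'))|
    <= 2 * C * (D + Z * H `^ gamma) * H ;
  field2_tens : forall a u v, F a (tens u v) = frechet f a (f a u) v ;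
  field2_bounded : forall a, `|F a| <= K ;
  field2_lipschitz : forall a b, `|F b - F a| <= K * `|b - a| ;
  field2_difference : forall a b a' b' (H Z D : R),
    `|b - a| <= H -> `|b' - a'| <= H -> `|a - a'| <= Z -> `|b - b'| <= Z ->
    `|(b - a) - (b' - a')| <= D ->
    `|F b - F a - (F b' - F a')| <= K * (D + Z * (H + H `^ gamma)) }.

(** [frechet f] satisfies [second_difference_le] with the exponent [gamma], and
    [f] with the exponent 1 as [frechet f] is Lipschitz. The bounds for the lifted
    product follow by the Leibniz rule, values on elementary tensors being enough
    by [tens_clin_norm_le]. *)
Lemma second_order_fieldP (tens : U -> U -> W) (gamma : R) (f : V -> clin U V) :
  0 < gamma -> tensor_square tens -> Cb 2 gamma f ->
  exists C K : R, [/\ 0 <= C, 0 <= K & second_order_field tens gamma C K f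
    (fun a => tensor_lift tens (fun u v => frechet f a (f a u) v))].
Proof.
move=> g0 tensP [[C0 fC0] _ [df [[C1 dfC1] _ [ddf [[C2 ddfC2] _ [C3 holC3]]]]]].
pose C := `|C0| + `|C1| + `|C2| + `|C3|.
have [n0 n1 n2 n3] := And4 (normr_ge0 C0) (normr_ge0 C1) (normr_ge0 C2) (normr_ge0 C3).
have [m0 m1 m2 m3] := And4 (ler_norm C0) (ler_norm C1) (ler_norm C2) (ler_norm C3).
have CC0 : 0 <= C by rewrite /C; lra.
have fC a : `|f a| <= C by rewrite (le_trans (fC0 a)) // /C; lra.
have dfC a : `|frechet f a| <= C by rewrite (le_trans (dfC1 a)) // /C; lra.
have ddfC a : `|frechet (frechet f) a| <= C by rewrite (le_trans (ddfC2 a)) // /C; lra.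
have hol a b : `|frechet (frechet f) b - frechet (frechet f) a| <= C * `|b - a| `^ gamma.
  by rewrite (le_trans (holC3 a b)) // ler_wpM2r ?powR_ge0 // /C; lra.
have lf := lipschitz_of_frechet df dfC.
have ldf := lipschitz_of_frechet ddf ddfC.
have f4 a b a' b' (H Z D : R) :
    `|b - a| <= H -> `|b' - a'| <= H -> `|a - a'| <= Z -> `|b - b'| <= Z ->
    `|(b - a) - (b' - a')| <= D -> `|f b - f a - (f b' - f a')| <= C * (D + Z * H).
  move=> h h' z z' d.
  have H0 : 0 <= H by exact: le_trans h.
  rewrite (le_trans (second_difference_le CC0 ler01 df dfC _ h h' z z')) //.
    by move=> x y; rewrite powRr1 // ldf.
  by rewrite powRr1 // ler_wpM2l // lerD2r.
have df4 a b a' b' (H Z D : R) :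
    `|b - a| <= H -> `|b' - a'| <= H -> `|a - a'| <= Z -> `|b - b'| <= Z ->
    `|(b - a) - (b' - a')| <= D ->
    `|frechet f b - frechet f a - (frechet f b' - frechet f a')|
    <= C * (D + Z * H `^ gamma).
  move=> h h' z z' d.
  rewrite (le_trans (second_difference_le CC0 (ltW g0) ddf ddfC hol h h' z z')) //.
  by rewrite ler_wpM2l // lerD2r.
have [K K0 normK] := tens_clin_norm_le tensP.
set F := (fun a : V => _).
have FE a u v : F a (tens u v) = frechet f a (f a u) v.
  rewrite /F; apply: (tensor_liftE tensP (C := C * C)).
  - split=> [u' k x y|v' k x y]; first by rewrite clin_is_linear.
    by rewrite !clin_is_linear.
  - by rewrite mulr_ge0.
  move=> x y; rewrite (le_trans (le_clin _ _)) // ler_wpM2r //.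
  by rewrite (le_trans (le_clin _ _)) // -mulrA ler_pM // (le_trans (le_clin _ _)) // ler_wpM2r.
have FV := normK V.
have CC : 0 <= C * C by rewrite mulr_ge0.
have le_app2 (g : clin V (clin U V)) (h : clin U V) u v (x y : R) :
    `|g| <= x -> `|h| <= y -> `|g (h u) v| <= x * y * `|u| * `|v|.
  move=> gx hy; rewrite (le_trans (le_clin _ _)) // ler_wpM2r //.
  rewrite (le_trans (le_clin _ _)) // -mulrA ler_pM //.
  by rewrite (le_trans (le_clin _ _)) // ler_wpM2r.
have KCC : 0 <= K * (C * C) by rewrite mulr_ge0.
exists C, (3 * K * (C * C)); split => //; first by rewrite -mulrA mulr_ge0.
split=> //.
- move=> a b a' b' H Z D h h' z z' d.
  have H0 : 0 <= H by exact: le_trans h.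
  have Z0 : 0 <= Z by exact: le_trans z.
  rewrite (le_trans (taylor_difference_le (eps := C * (D + Z * H `^ gamma))
    CC0 df ldf _ h h' z z' d)) //.
    by move=> x x' hx hx' zx dx; apply: df4.
  rewrite ler_wpM2r //.
  have := mulr_ge0 CC0 (mulr_ge0 Z0 (powR_ge0 H gamma)); lra.
- move=> a; apply: (@le_trans _ _ (K * (C * C))); last lra.
  by apply: FV => // u v; rewrite FE; exact: le_app2.
- move=> a b; apply: (@le_trans _ _ (K * (2 * (C * C) * `|b - a|))); last first.
    by have := mulr_ge0 KCC (normr_ge0 (b - a)); lra.
  apply: FV => [|u v]; first by rewrite !mulr_ge0.
  rewrite subclinE !FE.
  rewrite product_difference.
  rewrite (le_trans (ler_normD _ _)) //.
  have i1 := le_app2 _ _ u v _ _ (ldf a b) (fC b).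
  have i2 := le_app2 _ _ u v _ _ (dfC a) (lf a b).
  apply: (le_trans (lerD i1 i2)).
  move: `|b - a| `|u| `|v| => x n m; clear; lra.
move=> a b a' b' H Z D h h' z z' d.
have H0 : 0 <= H by exact: le_trans h.
have Z0 : 0 <= Z by exact: le_trans z.
have D0 : 0 <= D by exact: le_trans d.
set P := H `^ gamma; have P0 : 0 <= P by exact: powR_ge0.
apply: (@le_trans _ _ (K * (3 * (C * C) * (D + Z * (H + P))))); last lra.
apply: FV => [|u v].
  by rewrite !mulr_ge0 // addr_ge0 // mulr_ge0 // addr_ge0.
rewrite !subclinE !FE.
rewrite product_second_difference.
rewrite (le_trans (ler_normD _ _)) //.
rewrite (le_trans (lerD (ler_normD _ _) (lexx _))) //.
rewrite (le_trans (lerD (lerD (ler_normD _ _) (lexx _)) (lexx _))) //.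
have := le_app2 _ _ u v _ _ (df4 _ _ _ _ _ _ _ h h' z z' d) (fC b).
have := le_app2 _ _ u v _ _ (le_trans (ldf a' b') (ler_wpM2l CC0 h'))
   (le_trans (lf b' b) (ler_wpM2l CC0 z')).
have := le_app2 _ _ u v _ _ (le_trans (ldf a' a) (ler_wpM2l CC0 z))
   (le_trans (lf a b) (ler_wpM2l CC0 h)).
have := le_app2 _ _ u v _ _ (dfC a') (f4 _ _ _ _ _ _ _ h h' z z' d).
rewrite -/P; set n := `|u|; set m := `|v| => i1 i2 i3 i4.
have nm0 : 0 <= n * m := mulr_ge0 (normr_ge0 _) (normr_ge0 _).
apply: (le_trans (lerD (lerD (lerD i4 i3) i2) i1)).
have := mulr_ge0 (mulr_ge0 CC nm0) D0.
have := mulr_ge0 (mulr_ge0 CC nm0) (mulr_ge0 Z0 P0).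
lra.
Qed.

End VectorField.

(** * The rough step is a stable scheme *)

Section StepEstimates.
Context {R : realType} {U V : completeNormedModType R} {W : normedModType R}.
Context {tens : U -> U -> W} {gamma C K : R} {f : V -> clin U V} {F : V -> clin W V}.
Hypothesis (g0 : 0 < gamma) (g1 : gamma <= 1) (C0 : 0 <= C) (K0 : 0 <= K).
Hypothesis fF : second_order_field tens gamma C K f F.

Definition taylor (a b : V) : clin U V := f b - f a - frechet f a (b - a).

(** The error made by two steps in place of one, [w1] and [v, w2] being the data
    of the rough path on the two intervals, when the first step leads from [a] to
    [b] with the error [rho]. The first order part of
    [b - a] has cancelled against the tensor term of Chen's relation, so that what
    remains is of order 3 in the size of the path, up to the term in [rho]. *)
Definition defect (v : U) (w1 w2 : W) (a b rho : V) : V :=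
  taylor a b v + frechet f a (F a w1 + rho) v + (F b - F a) w2.

(** The term [tens u v] of Chen's relation produces [frechet f a (f a u) v],
    which is the first order term of [f b v - f a v]. *)
Lemma defectE (u v : U) (w1 w2 : W) (a b : V) :
  (b + f b v + F b w2) - (a + f a (u + v) + F a (w1 + w2 + tens u v))
    - (b - (a + f a u + F a w1)) =
  defect v w1 w2 a b (b - (a + f a u + F a w1)).
Proof.
rewrite /defect /taylor (clinD (f a) u v) (clinD (F a) (w1 + w2)) (clinD (F a) w1 w2).
rewrite (field2_tens fF).
have -> : frechet f a (F a w1 + (b - (a + f a u + F a w1))) v =
    frechet f a (b - a) v - frechet f a (f a u) v.
  have -> : F a w1 + (b - (a + f a u + F a w1)) = (b - a) - f a u by abelian.
  by rewrite (clinB (frechet f a)) .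
have -> : (f b - f a - frechet f a (b - a) : clin U V) v =
   f b v - f a v - frechet f a (b - a) v by [].
have -> : (F b - F a : clin W V) w2 = F b w2 - F a w2 by [].
move: (f b v) (F b w2) (f a u) (f a v) (F a w1) (F a w2) (frechet f a (f a u) v)
  (frechet f a (b - a) v) => *; by abelian.
Qed.

Lemma defect_difference v w1 w2 a b rho a' b' rho' :
  defect v w1 w2 a b rho - defect v w1 w2 a' b' rho' =
    (taylor a b - taylor a' b') v +
    (frechet f a - frechet f a') (F a w1 + rho) v +
    frechet f a' ((F a - F a') w1 + (rho - rho')) v +
    (F b - F a - (F b' - F a')) w2.
Proof.
rewrite /defect.
have -> : (taylor a b - taylor a' b' : clin U V) v = taylor a b v - taylor a' b' v by [].
have -> : (frechet f a - frechet f a' : clin V (clin U V)) (F a w1 + rho) v =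
  frechet f a (F a w1 + rho) v - frechet f a' (F a w1 + rho) v by [].
have -> : frechet f a' ((F a - F a' : clin W V) w1 + (rho - rho')) v =
   frechet f a' (F a w1 + rho) v - frechet f a' (F a' w1 + rho') v.
  have -> : (F a - F a' : clin W V) w1 + (rho - rho') =
    (F a w1 + rho) - (F a' w1 + rho').
    have -> : (F a - F a' : clin W V) w1 = F a w1 - F a' w1 by [].
    by abelian.
  by rewrite (clinB (frechet f a')).
have -> : (F b - F a - (F b' - F a') : clin W V) w2 =
  (F b - F a : clin W V) w2 - (F b' - F a' : clin W V) w2 by [].
by abelian.
Qed.

Lemma le_clin_of (X Y : normedModType R) (g : clin X Y) (x : X) (c d : R) :
  `|g| <= c -> `|x| <= d -> `|g x| <= c * d.
Proof. by move=> gc xd; rewrite (le_trans (le_clin _ _)) // ler_pM. Qed.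

Lemma scaled_powR_le (H eta : R) : 1 <= H -> 0 <= eta ->
  (H * eta) `^ gamma <= H * eta `^ gamma.
Proof.
move=> H1 e0; rewrite powRM //; last lra.
by rewrite ler_wpM2r ?powR_ge0 // ler1_powR.
Qed.

Lemma le_powR_self (eta : R) : 0 <= eta -> eta <= 1 -> eta <= eta `^ gamma.
Proof.
rewrite le_eqVlt => /predU1P[<-|e0] e1; first exact: powR_ge0.
by rewrite ger1_powR // e0.
Qed.

(** In these estimates [eta] stands for [omega `^ (1 / p)] on the whole
    interval. *)
Lemma increment_le (B eta : R) (u : U) (w : W) a : 0 <= eta -> eta <= 1 -> 0 <= B ->
  `|u| <= B * eta -> `|w| <= B * eta ^+ 2 ->
  `|f a u + F a w| <= (C + K) * B * eta.
Proof.
move=> e0 e1 B0 uB wB; rewrite (le_trans (ler_normD _ _)) //.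
have h1 := le_clin_of (field_bounded fF a) uB.
have h2 := le_clin_of (field2_bounded fF a) wB.
have ee : eta ^+ 2 <= eta by rewrite expr2 ler_piMr.
have := ler_wpM2l (mulr_ge0 K0 B0) ee; lra.
Qed.

Lemma increment_difference_le (B eta : R) (u : U) (w : W) a b :
  0 <= eta -> eta <= 1 -> 0 <= B ->
  `|u| <= B * eta -> `|w| <= B * eta ^+ 2 ->
  `|(f a u + F a w) - (f b u + F b w)| <= (C + K) * B * eta * `|a - b|.
Proof.
move=> e0 e1 B0 uB wB.
have -> : f a u + F a w - (f b u + F b w) = (f a - f b) u + (F a - F b) w.
  by rewrite !subclinE; abelian.
rewrite (le_trans (ler_normD _ _)) //.
have h1 := le_clin_of (field_lipschitz fF b a) uB.
have h2 := le_clin_of (field2_lipschitz fF b a) wB.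
have ee : eta ^+ 2 <= eta by rewrite expr2 ler_piMr.
have := ler_wpM2l (mulr_ge0 (mulr_ge0 K0 B0) (normr_ge0 (a - b))) ee; lra.
Qed.

(** Each term of [defect_difference] is a product in which the powers of [eta]
    add up to at least [2 + gamma], with a factor [Z], except those that contain
    the difference [rho - rho'] of the errors, which have at least one factor
    [eta]. *)
Lemma defect_difference_le (B L : R) : 0 <= B -> 0 <= L ->
  exists2 Q : R, 0 <= Q & forall (u v : U) (w1 w2 : W) a b a' b' (eta Z : R),
  0 <= eta -> eta <= 1 ->
  `|u| <= B * eta -> `|v| <= B * eta -> `|w1| <= B * eta ^+ 2 -> `|w2| <= B * eta ^+ 2 ->
  let rho := b - (a + f a u + F a w1) in
  let rho' := b' - (a' + f a' u + F a' w1) in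
  `|rho| <= L * (eta ^+ 2 * eta `^ gamma) ->
  `|rho'| <= L * (eta ^+ 2 * eta `^ gamma) ->
  `|a - a'| <= Z -> `|b - b'| <= Z ->
  `|defect v w1 w2 a b rho - defect v w1 w2 a' b' rho'| <=
    Q * (eta * `|rho - rho'| + Z * (eta ^+ 2 * eta `^ gamma)).
Proof.
(* [G * eta] bounds the Lipschitz constants of the increments, [H * eta] the
   increments with their errors. *)
move=> B0 L0; pose G := (C + K) * B; pose H := G + L + 1.
have G0 : 0 <= G by rewrite /G mulr_ge0 // addr_ge0.
have H1 : 1 <= H by rewrite /H; lra.
have H0 : 0 <= H by lra.
exists (2 * C * H * B * (1 + G + H) + C * B * (K * B + L) + C * B * (K * B + 1)
   + K * B * (1 + G + 2 * H)).
  by rewrite !addr_ge0 // !mulr_ge0 // !addr_ge0 // ?mulr_ge0.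
move=> u v w1 w2 a b a' b' eta Z e0 e1 uB vB w1B w2B rho rho' rL rL' aZ bZ.
set kap := eta `^ gamma in rL rL' *.
have kap0 : 0 <= kap by exact: powR_ge0.
have ek : eta <= kap by exact: le_powR_self.
have kap1 : kap <= 1.
  rewrite /kap -[leRHS](_ : 1 `^ gamma = 1); last by rewrite powR1.
  by apply: ge0_ler_powR; rewrite ?nnegrE // ltW.
have Z0 : 0 <= Z by exact: le_trans aZ.
set J := `|rho - rho'|; have J0 : 0 <= J by exact: normr_ge0.
have e2 : eta ^+ 2 <= eta by rewrite expr2 ler_piMr.
have e20 : 0 <= eta ^+ 2 by rewrite exprn_ge0.
have e2k : eta ^+ 2 * kap <= eta ^+ 2 by rewrite ler_piMr.
have e2k0 : 0 <= eta ^+ 2 * kap by rewrite mulr_ge0.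
have e3 : eta ^+ 2 * eta <= eta ^+ 2 * kap by rewrite ler_wpM2l.
have baE (x y : V) : y - x = (f x u + F x w1) + (y - (x + f x u + F x w1)).
  by abelian.
have ba (x y : V) : `|y - (x + f x u + F x w1)| <= L * (eta ^+ 2 * kap) ->
    `|y - x| <= H * eta.
  move=> yx; rewrite baE (le_trans (ler_normD _ _)) //.
  have := increment_le x e0 e1 B0 uB w1B; rewrite -/G /H.
  have := ler_wpM2l L0 (le_trans e2k e2); lra.
pose D := J + G * Z * eta.
have baD : `|(b - a) - (b' - a')| <= D.
  have -> : b - a - (b' - a') = (rho - rho') +
      ((f a u + F a w1) - (f a' u + F a' w1)) by rewrite /rho /rho'; abelian.
  rewrite (le_trans (ler_normD _ _)) // /D lerD2l.
  have := increment_difference_le a a' e0 e1 B0 uB w1B.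
  have := ler_wpM2l (mulr_ge0 G0 e0) aZ; rewrite -/G; lra.
have Hk : (H * eta) `^ gamma <= H * kap by exact: scaled_powR_le.
have C20 : 0 <= 2 * C by rewrite mulr_ge0.
have He0 : 0 <= H * eta by rewrite mulr_ge0.
have t1 : `|(taylor a b - taylor a' b') v| <=
    2 * C * (D + Z * (H * kap)) * (H * eta) * (B * eta).
  apply: le_clin_of vB.
  rewrite (le_trans (field_taylor fF (ba _ _ rL) (ba _ _ rL') aZ bZ baD)) //.
  by rewrite ler_wpM2r // ler_wpM2l // lerD2l ler_wpM2l.
have t2 : `|(frechet f a - frechet f a') (F a w1 + rho) v| <=
    C * Z * (K * (B * eta ^+ 2) + L * (eta ^+ 2 * kap)) * (B * eta).
  apply: le_clin_of vB; apply: le_clin_of.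
    by rewrite (le_trans (field_deriv_lipschitz fF a' a)) // ler_wpM2l.
  rewrite (le_trans (ler_normD _ _)) // lerD //.
  by apply: le_clin_of w1B; exact: (field2_bounded fF).
have t3 : `|frechet f a' ((F a - F a') w1 + (rho - rho')) v| <=
    C * (K * Z * (B * eta ^+ 2) + J) * (B * eta).
  apply: le_clin_of vB; apply: le_clin_of; first exact: (field_deriv_bounded fF).
  rewrite (le_trans (ler_normD _ _)) // lerD //.
  apply: le_clin_of w1B.
  by rewrite (le_trans (field2_lipschitz fF a' a)) // ler_wpM2l.
have t4 : `|(F b - F a - (F b' - F a')) w2| <=
    K * (D + Z * (H * eta + H * kap)) * (B * eta ^+ 2).
  apply: le_clin_of w2B.
  rewrite (le_trans (field2_difference fF (ba _ _ rL) (ba _ _ rL') aZ bZ baD)) //.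
  by rewrite ler_wpM2l // lerD2l ler_wpM2l // lerD2l.
rewrite defect_difference.
apply: (@le_trans _ _ (2 * C * (D + Z * (H * kap)) * (H * eta) * (B * eta)
  + C * Z * (K * (B * eta ^+ 2) + L * (eta ^+ 2 * kap)) * (B * eta)
  + C * (K * Z * (B * eta ^+ 2) + J) * (B * eta)
  + K * (D + Z * (H * eta + H * kap)) * (B * eta ^+ 2))).
  rewrite (le_trans (ler_normD _ _)) // lerD //.
  rewrite (le_trans (ler_normD _ _)) // lerD //.
  by rewrite (le_trans (ler_normD _ _)) // lerD.
clear t1 t2 t3 t4 baD ba baE uB vB w1B w2B rL rL' aZ bZ Hk.
rewrite /D; set X := eta * J; set Y := Z * (eta ^+ 2 * kap).
have Y0 : 0 <= Y by rewrite mulr_ge0.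
have X0 : 0 <= X by rewrite mulr_ge0.
have m1 : eta ^+ 2 * J <= X by rewrite ler_wpM2r.
have m2 : Z * (eta ^+ 2 * eta) <= Y by rewrite ler_wpM2l.
have m3 : Z * (eta ^+ 2 * eta) * kap <= Y.
  by rewrite (le_trans _ m2) // ler_piMr // mulr_ge0 // mulr_ge0.
have CHB : 0 <= 2 * C * H * B by rewrite !mulr_ge0.
have p1 : 2 * C * (J + G * Z * eta + Z * (H * kap)) * (H * eta) * (B * eta)
   <= 2 * C * H * B * (X + (G + H) * Y).
  have -> : 2 * C * (J + G * Z * eta + Z * (H * kap)) * (H * eta) * (B * eta) =
    2 * C * H * B * (eta ^+ 2 * J + G * (Z * (eta ^+ 2 * eta)) + H * Y).
    by rewrite /Y; ring.
  rewrite ler_wpM2l // [(G + H) * Y]mulrDl addrA lerD2r lerD //.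
  by rewrite ler_wpM2l.
have p2 : C * Z * (K * (B * eta ^+ 2) + L * (eta ^+ 2 * kap)) * (B * eta) <=
    C * B * ((K * B + L) * Y).
  have -> : C * Z * (K * (B * eta ^+ 2) + L * (eta ^+ 2 * kap)) * (B * eta) =
    C * B * (K * B * (Z * (eta ^+ 2 * eta)) + L * (Z * (eta ^+ 2 * eta) * kap)).
    by ring.
  rewrite ler_wpM2l ?mulr_ge0 // mulrDl lerD // ler_wpM2l // mulr_ge0 //.
have p3 : C * (K * Z * (B * eta ^+ 2) + J) * (B * eta) <= C * B * (K * B * Y + X).
  have -> : C * (K * Z * (B * eta ^+ 2) + J) * (B * eta) =
     C * B * (K * B * (Z * (eta ^+ 2 * eta)) + X) by rewrite /X; ring.
  by rewrite ler_wpM2l ?mulr_ge0 // lerD2r ler_wpM2l ?mulr_ge0.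
have p4 : K * (J + G * Z * eta + Z * (H * eta + H * kap)) * (B * eta ^+ 2) <=
    K * B * (X + (G + 2 * H) * Y).
  have -> : K * (J + G * Z * eta + Z * (H * eta + H * kap)) * (B * eta ^+ 2) =
     K * B * (eta ^+ 2 * J + ((G + H) * (Z * (eta ^+ 2 * eta)) + H * Y)).
    by rewrite /Y; ring.
  rewrite ler_wpM2l ?mulr_ge0 // lerD //.
  have := ler_wpM2l (addr_ge0 G0 H0) m2; lra.
apply: (le_trans (lerD (lerD (lerD p1 p2) p3) p4)).
clear p1 p2 p3 p4 m1 m2 m3.
have GH : 0 <= G + H by rewrite addr_ge0.
have q1 := mulr_ge0 CHB Y0; have q1' := mulr_ge0 CHB (mulr_ge0 GH X0).
have q2 := mulr_ge0 (mulr_ge0 C0 B0) (mulr_ge0 (addr_ge0 (mulr_ge0 K0 B0) L0) X0).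
have q3 := mulr_ge0 (mulr_ge0 C0 B0) Y0.
have q3' := mulr_ge0 (mulr_ge0 C0 B0) (mulr_ge0 (mulr_ge0 K0 B0) X0).
have q4 := mulr_ge0 (mulr_ge0 K0 B0) Y0.
have q4' := mulr_ge0 (mulr_ge0 K0 B0) (mulr_ge0 (addr_ge0 GH H0) X0).
rewrite -subr_ge0; set s := (X in 0 <= X).
have -> : s = 2 * C * H * B * Y + 2 * C * H * B * ((G + H) * X) +
   C * B * ((K * B + L) * X) + C * B * Y + C * B * (K * B * X) +
   K * B * Y + K * B * ((G + H + H) * X).
  by rewrite /s; ring.
by rewrite !addr_ge0.
Qed.

(** [defect] at an exact step: the Taylor remainder is estimated as a difference
    with the trivial remainder at [a], which amounts to taking [a' = b' = a]. *)
Lemma defect_le (B : R) : 0 <= B ->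
  exists2 Q : R, 0 <= Q & forall (u v : U) (w1 w2 : W) a (eta : R),
  0 <= eta -> eta <= 1 ->
  `|u| <= B * eta -> `|v| <= B * eta -> `|w1| <= B * eta ^+ 2 -> `|w2| <= B * eta ^+ 2 ->
  `|defect v w1 w2 a (a + f a u + F a w1) 0| <= Q * (eta ^+ 2 * eta `^ gamma).
Proof.
move=> B0; pose G := (C + K) * B; pose H := G + 1.
have G0 : 0 <= G by rewrite /G mulr_ge0 // addr_ge0.
have H1 : 1 <= H by rewrite /H; lra.
have H0 : 0 <= H by lra.
exists (2 * C * (H + H * H) * H * B + C * K * B * B + K * H * B).
  by rewrite !addr_ge0 // !mulr_ge0 // addr_ge0 // mulr_ge0.
move=> u v w1 w2 a eta e0 e1 uB vB w1B w2B.
set kap := eta `^ gamma; set b := a + f a u + F a w1.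
have kap0 : 0 <= kap by exact: powR_ge0.
have ek : eta <= kap by exact: le_powR_self.
have kap1 : kap <= 1.
  rewrite /kap -[leRHS](_ : 1 `^ gamma = 1); last by rewrite powR1.
  by apply: ge0_ler_powR; rewrite ?nnegrE // ltW.
have e20 : 0 <= eta ^+ 2 by rewrite exprn_ge0.
have e3 : eta ^+ 2 * eta <= eta ^+ 2 * kap by rewrite ler_wpM2l.
have He0 : 0 <= H * eta by rewrite mulr_ge0.
have ba : `|b - a| <= H * eta.
  have -> : b - a = f a u + F a w1 by rewrite /b; abelian.
  have := increment_le a e0 e1 B0 uB w1B; rewrite -/G /H; lra.
have Hk : (H * eta) `^ gamma <= H * kap by exact: scaled_powR_le.
have t1 : `|taylor a b v| <= 2 * C * (H * eta + H * eta * H) * (H * eta) * (B * eta).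
  apply: le_clin_of vB.
  have -> : taylor a b = taylor a b - taylor a a.
    rewrite [taylor a a](_ : _ = 0) ?subr0 // /taylor !subrr.
    by rewrite -[X in frechet f a X](subrr 0) clinB !subrr.
  have aa : `|a - a| <= H * eta by rewrite subrr normr0.
  have baa : `|(b - a) - (a - a)| <= H * eta by rewrite subrr subr0.
  apply: le_trans (field_taylor fF ba aa aa ba baa) _.
  rewrite ler_wpM2r // ler_wpM2l ?mulr_ge0 // lerD2l ler_wpM2l //.
  by rewrite (le_trans Hk) // ler_piMr.
have t2 : `|frechet f a (F a w1 + 0) v| <= C * (K * (B * eta ^+ 2)) * (B * eta).
  rewrite addr0; apply: le_clin_of vB; apply: le_clin_of; first exact: (field_deriv_bounded fF).
  by apply: le_clin_of w1B; exact: (field2_bounded fF).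
have t3 : `|(F b - F a) w2| <= K * (H * eta) * (B * eta ^+ 2).
  by apply: le_clin_of w2B; rewrite (le_trans (field2_lipschitz fF a b)) // ler_wpM2l.
rewrite /defect; apply: (@le_trans _ _ ((2 * C * (H + H * H) * H * B
    + C * K * B * B + K * H * B) * (eta ^+ 2 * eta))); last first.
  rewrite ler_wpM2l // !addr_ge0 // !mulr_ge0 // addr_ge0 // mulr_ge0 //.
rewrite (le_trans (ler_normD _ _)) //.
rewrite (le_trans (lerD (ler_normD _ _) (lexx _))) //.
apply: (le_trans (lerD (lerD t1 t2) t3)).
rewrite -subr_ge0; set s := (X in 0 <= X).
have -> : s = 0 by rewrite /s; ring.
by [].
Qed.

End StepEstimates.

Section RoughStep.
Context {R : realType} {U V : completeNormedModType R} {W : normedModType R}.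
Context {tens : U -> U -> W} {T p gamma : R} {omega : R -> R -> R}.
Context {x1 : R -> R -> U} {x2 : R -> R -> W} {f : V -> clin U V}.
Hypotheses (p2 : 2 <= p) (g0 : 0 < gamma) (g1 : gamma <= 1).
Hypotheses (tensP : tensor_square tens) (om : control T omega).
Hypotheses (xP : rough_path tens T p omega x1 x2) (fC : Cb 2 gamma f).

Let p0 : 0 < p. Proof. exact: lt_le_trans p2. Qed.

Lemma control_le r s t u : 0 <= r -> r <= s -> s <= t -> t <= u -> u <= T ->
  omega s t <= omega r u.
Proof.
move=> r0 rs st tu uT; have [w0 ws _ _] := om.
have st' : s <= u by exact: le_trans tu.
have := ws r s u r0 rs st' uT.
have := ws s t u (le_trans r0 rs) st tu uT.
have := w0 r s r0 rs (le_trans st' uT).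
have := w0 t u (le_trans (le_trans r0 rs) st) tu uT.
lra.
Qed.

Lemma rough_path_diag s : 0 <= s -> s <= T -> x1 s s = 0 /\ x2 s s = 0.
Proof.
move=> s0 sT.
have x0 : x1 s s = 0.
  have := rough_path_add xP s0 (lexx s) (lexx s) sT.
  by move=> /eqP; rewrite -subr_eq subrr eq_sym => /eqP.
split => //; have := rough_path_chen xP s0 (lexx s) (lexx s) sT.
have [bl br] := tens_bilinear tensP.
have t0 : tens 0 0 = 0.
  apply/eqP; rewrite -normr_le0 (le_trans (tens_norm tensP _ _)) //.
  by rewrite normr0 mul0r.
by rewrite x0 t0 addr0 => /eqP; rewrite -subr_eq subrr eq_sym => /eqP.
Qed.

(** The path is estimated by the control of a larger interval, for the estimates
    of two successive steps to involve a single quantity. *)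
Lemma rough_path_bounds : exists2 B : R, 0 <= B & forall r s t u,
  0 <= r -> r <= s -> s <= t -> t <= u -> u <= T ->
  `|x1 s t| <= B * omega r u `^ (1 / p) /\
  `|x2 s t| <= B * (omega r u `^ (1 / p)) ^+ 2.
Proof.
have [C1 b1] := rough_path_bound1 xP; have [C2 b2] := rough_path_bound2 xP.
exists (`|C1| + `|C2|); first by rewrite addr_ge0.
move=> r s t u r0 rs st tu uT.
have s0 : 0 <= s by lra.
have tT : t <= T by lra.
have w0 : 0 <= omega s t by case: om => w0 _ _ _; apply: w0.
have wle : omega s t `^ (1 / p) <= omega r u `^ (1 / p).
  apply: ge0_ler_powR; rewrite ?nnegrE //; first by rewrite divr_ge0 // ltW.
    exact: le_trans (control_le r0 rs st tu uT).
  exact: control_le.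
have w20 : 0 <= omega r u `^ (1 / p) by exact: powR_ge0.
have [ts|st_neq] := eqVneq s t.
  have [] := rough_path_diag s0 (le_trans st tT); rewrite -{}ts => -> ->.
  by rewrite !normr0 !mulr_ge0 ?addr_ge0 ?exprn_ge0.
have slt : s < t by rewrite lt_neqAle st_neq.
split.
  apply: (le_trans (b1 s t s0 slt tT)).
  apply: (@le_trans _ _ ((`|C1| + `|C2|) * omega s t `^ (1 / p))).
    rewrite ler_wpM2r ?powR_ge0 //; have := ler_norm C1; have := normr_ge0 C2; lra.
  by rewrite ler_wpM2l // addr_ge0.
apply: (le_trans (b2 s t s0 slt tT)).
apply: (@le_trans _ _ ((`|C1| + `|C2|) * omega s t `^ (2 / p))).
  rewrite ler_wpM2r ?powR_ge0 //; have := ler_norm C2; have := normr_ge0 C1; lra.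
rewrite ler_wpM2l ?addr_ge0 //.
have -> : 2 / p = 1 / p * 2 by rewrite mul1r mulrC.
rewrite powRrM powR_mulrn ?powR_ge0 //.
by rewrite !expr2 ler_pM ?powR_ge0.
Qed.

(** The last two fields are [defect_le] and [defect_difference_le]: with
    [eta = omega r t `^ (1 / p)], their [eta ^+ 2 * eta `^ gamma] is
    [omega r t `^ ((2 + gamma) / p)]. *)
Lemma rough_step_stable :
  stable_scheme T omega (1 / p) ((2 + gamma) / p) (rough_step tens x1 x2 f).
Proof.
have [C [K [C0 K0 fF]]] := second_order_fieldP g0 tensP fC.
set F := (fun a : V => _) in fF.
have [B B0 xB] := rough_path_bounds.
have phiE t s a : rough_step tens x1 x2 f t s a = a + f a (x1 s t) + F a (x2 s t) by [].
have w0 s t : 0 <= s -> s <= t -> t <= T -> 0 <= omega s t.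
  by case: om => w0 _ _ _; apply: w0.
have e01 s t : 0 <= s -> s <= t -> t <= T -> omega s t <= 1 -> omega s t `^ (1 / p) <= 1.
  move=> s0 st tT w1; apply: (@le_trans _ _ (1 `^ (1 / p))); last by rewrite powR1.
  by apply: ge0_ler_powR; rewrite ?nnegrE ?divr_ge0 ?w0 // ltW.
have thE s t : omega s t `^ ((2 + gamma) / p) =
    (omega s t `^ (1 / p)) ^+ 2 * (omega s t `^ (1 / p)) `^ gamma.
  rewrite -powR_mulrn ?powR_ge0 // -powRD; last first.
    by rewrite gt_eqF // addr_gt0.
  by rewrite -powRrM mul1r mulrC.
have incE s t a : rough_step tens x1 x2 f t s a - a = f a (x1 s t) + F a (x2 s t).
  by rewrite phiE; abelian.
split.
- move=> t a t0 tT; have [x10 x20] := rough_path_diag t0 tT.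
  rewrite phiE x10 x20.
  have -> : f a 0 = 0 by rewrite -[X in f a X](subrr 0) clinB subrr.
  have -> : F a 0 = 0 by rewrite -[X in F a X](subrr 0) clinB subrr.
  by rewrite !addr0.
- pose e := omega 0 T `^ (1 / p).
  exists (C * (B * e) + K * (B * e ^+ 2)) => s t a s0 st tT.
  have [x1B x2B] := xB 0 s t T (lexx _) s0 st tT (lexx _).
  rewrite incE (le_trans (ler_normD _ _)) // lerD //.
    exact: le_clin_of (field_bounded fF a) x1B.
  exact: le_clin_of (field2_bounded fF a) x2B.
- exists ((C + K) * B); first by rewrite mulr_ge0 // addr_ge0.
  move=> s t a s0 st tT w1; rewrite incE.
  have [x1B x2B] := xB s s t t s0 (lexx _) st (lexx _) tT.
  by apply: (increment_le K0 fF a _ _ B0 x1B x2B); rewrite ?powR_ge0 ?e01.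
- exists ((C + K) * B); first by rewrite mulr_ge0 // addr_ge0.
  move=> s t a b s0 st tT w1; rewrite !incE.
  have [x1B x2B] := xB s s t t s0 (lexx _) st (lexx _) tT.
  by apply: (increment_difference_le K0 fF a b _ _ B0 x1B x2B); rewrite ?powR_ge0 ?e01.
- have [Q Q0 dQ] := defect_le g0 g1 C0 K0 fF B0.
  exists Q => // r s t a r0 rs st tT w1.
  have [u1 w1'] := xB r r s t r0 (lexx _) rs st tT.
  have [v1 w2'] := xB r s t t r0 rs st (lexx _) tT.
  have rt : r <= t by exact: le_trans st.
  have := dQ _ _ _ _ a _ (powR_ge0 _ _) (e01 _ _ r0 rt tT w1) u1 v1 w1' w2'.
  rewrite thE; set b := rough_step tens x1 x2 f s r a.
  have bE : b = a + f a (x1 r s) + F a (x2 r s) by [].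
  have := defectE fF (x1 r s) (x1 s t) (x2 r s) (x2 s t) a b.
  rewrite -(rough_path_add xP r0 rs st tT) -(rough_path_chen xP r0 rs st tT).
  by rewrite -bE subrr subr0 => <-.
move=> L L0; have [Q Q0 dQ] := defect_difference_le g0 g1 C0 K0 fF B0 L0.
exists Q => // r s t a a' b b' Z r0 rs st tT w1.
have [u1 w1'] := xB r r s t r0 (lexx _) rs st tT.
have [v1 w2'] := xB r s t t r0 rs st (lexx _) tT.
have rt : r <= t by exact: le_trans st.
have := dQ _ _ _ _ a b a' b' _ Z (powR_ge0 _ _) (e01 _ _ r0 rt tT w1) u1 v1 w1' w2'.
cbv zeta; rewrite -thE -!(defectE fF).
rewrite -(rough_path_add xP r0 rs st tT) -(rough_path_chen xP r0 rs st tT).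
move=> {}dQ h h' aZ bZ.
have wrs : omega r s `^ ((2 + gamma) / p) <= omega r t `^ ((2 + gamma) / p).
  apply: ge0_ler_powR; rewrite ?nnegrE ?w0 //.
  - by rewrite divr_ge0 ?ltW // addr_gt0.
  - exact: le_trans tT.
  exact: control_le.
apply: dQ => //.
  by rewrite (le_trans h) // ler_wpM2l.
by rewrite (le_trans h') // ler_wpM2l.
Qed.

End RoughStep.

(** * Products along grids *)

Section ProductsAlongGrids.
Context {R : realType} {V : normedModType R}.
Implicit Types (chi : R -> R -> V -> V) (l : seq R).

(** The final time is the last point of [l], whereas [chain] has it as a separate
    argument; so the products along concatenated grids compose. *)
Fixpoint prod_along chi (s : R) l (a : V) : V :=
  if l is u :: l' then prod_along chi u l' (chi u s a) else a.

Lemma chain_prod_along chi t s l a :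
  chain chi t s l a = prod_along chi s (rcons l t) a.
Proof. by elim: l s a => //= u l IH s a. Qed.

Lemma prod_along_cat chi s l l' a :
  prod_along chi s (l ++ l') a = prod_along chi (last s l) l' (prod_along chi s l a).
Proof. by elim: l s a => //= u l IH s a. Qed.

Lemma prod_along_take chi s l a i : (i < size l)%N ->
  prod_along chi s (take i.+1 l) a =
  chi (nth 0 (s :: l) i.+1) (nth 0 (s :: l) i) (prod_along chi s (take i l) a).
Proof.
by elim: l s a i => [|u l IH] s a [|i] //= il; [rewrite take0|rewrite IH].
Qed.

Definition fine (omega : R -> R -> R) (h : R) : rel R :=
  fun u v => (u <= v) && (omega u v <= h).

Lemma fine_weaken omega h h' s l : h <= h' ->
  path (fine omega h) s l -> path (fine omega h') s l.
Proof.
move=> hh'; apply: sub_path => u v /andP[uv wh].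
by rewrite /fine uv (le_trans wh).
Qed.

Lemma fine_le omega h s l : path (fine omega h) s l -> path <=%R s l.
Proof. by apply: sub_path => u v /andP[]. Qed.

Lemma path_le_last (s : R) l : path <=%R s l -> s <= last s l.
Proof.
elim: l s => //= u l IH s /andP[su ul]; exact: le_trans (IH _ ul).
Qed.

Lemma path_nth_le (s : R) l i j : path <=%R s l -> (i <= j)%N -> (j <= size l)%N ->
  nth 0 (s :: l) i <= nth 0 (s :: l) j.
Proof.
move=> sl ij jl.
apply: (@sorted_leq_nth _ <=%R le_trans lexx 0 (s :: l) sl); rewrite ?inE //=; nlia.
Qed.

Lemma path_mem_le (s : R) l u : path <=%R s l -> u \in s :: l -> s <= u /\ u <= last s l.
Proof.
move=> sl /(nthP 0)[i il <-]; split; first exact: (path_nth_le (i := 0) sl).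
by rewrite (last_nth 0); apply: path_nth_le.
Qed.

Lemma path_grid T (s : R) l : 0 <= s -> path <=%R s l -> last s l <= T ->
  grid T (nth 0 (s :: l)) 0 (size l).
Proof.
move=> s0 sl lT; split => //; first by rewrite nth_last.
by move=> i j _ ij jl; exact: path_nth_le.
Qed.

End ProductsAlongGrids.

Section UniformControl.
Context {R : realType} {T : R} {omega : R -> R -> R}.
Hypothesis om : control T omega.

(** Continuity at the points of the diagonal is uniform by compactness of
    [[0, T]]. *)
Lemma control_uniform (e : R) : 0 < e -> exists2 d : R, 0 < d & forall s t,
  0 <= s -> s <= t -> t <= T -> t - s < d -> omega s t <= e.
Proof.
move=> e0.
pose P (d : R) (s : R) := forall t, 0 <= s -> s <= t -> t <= T -> t - s < d -> omega s t <= e.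
have /compact_near_coveringP cK := @segment_compact R 0 T.
have : \forall d \near (0 : R)^'+, `[0, T]%classic `<=` P d.
  apply: cK => x /=; rewrite in_itv /= => /andP[x0 xT].
  have [_ _ /(_ x)/(_ _)] := om; rewrite x0 xT => /(_ erefl) + _.
  move=> /cvgrPdist_lt /(_ e e0).
  rewrite /within /= => /nbhs_ballP[r /= r0 ball_r].
  have r20 : 0 < r / 2 by rewrite divr_gt0.
  exists (ball x (r / 2), [set d : R | 0 < d /\ d < r / 2]) => /=.
    split; first exact: nbhsx_ballx.
    near=> d; split; near: d; first exact: nbhs_right_gt.
    exact: nbhs_right_lt.
  move=> [x' d] [/= xx' [d0 dr]] t x'0 x't tT td.
  have := ball_r (x', t); rewrite /ball /= /prod_ball /= => /(_ _ _).
  move: xx'; rewrite -!ball_normE /= => xx'.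
  have h1 : `|x - x'| < r by rewrite (lt_trans xx') //; lra.
  have h2 : `|x - t| < r.
    have := ler_normD (x - x') (x' - t); rewrite addrA subrK.
    by rewrite (distrC x' t) (ger0_norm (_ : 0 <= t - x')) ?subr_ge0 //; lra.
  move=> /(_ (conj h1 h2)); rewrite x'0 x't tT => /(_ (conj erefl erefl)).
  rewrite sub0r normrN => /ltW; apply: le_trans; exact: ler_norm.
move=> H; near (0 : R)^'+ => d; exists d.
  by near: d; exact: nbhs_right_gt.
have Pd : `[0, T]%classic `<=` P d by near: d.
move=> s t s0 st tT ts; apply: (Pd s) => //=.
by rewrite in_itv /= s0 (le_trans st).
Unshelve. all: by end_near. Qed.

(** The bound on the number of points serves to bound displacements uniformly
    over all intervals, see [limit_bounded]. *)
Lemma exists_fine_grid (h : R) : 0 < h -> exists N : nat, forall r t,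
  0 <= r -> r <= t -> t <= T ->
  exists l, [/\ path (fine omega h) r l, last r l = t & (size l <= N)%N].
Proof.
move=> h0; have [d d0 wd] := control_uniform h0.
have d20 : 0 < d / 2 by rewrite divr_gt0.
have key N r t : 0 <= r -> r <= t -> t <= T -> t - r <= N%:R * (d / 2) ->
    exists l, [/\ path (fine omega h) r l, last r l = t & (size l <= N)%N].
  elim: N r => [|N IH] r r0 rt tT.
    rewrite mul0r => tr; exists [::]; split => //=; lra.
  move=> trN; have [tr|tr] := lerP (t - r) (d / 2).
    exists [:: t]; split => //=; rewrite andbT /fine rt wd //; lra.
  have r'0 : 0 <= r + d / 2 by rewrite addr_ge0 // ltW.
  have r't : r + d / 2 <= t by rewrite addrC -lerBrDr ltW.
  have trN' : t - (r + d / 2) <= N%:R * (d / 2).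
    by rewrite opprD addrA lerBlDr; move: trN; rewrite -natr1 mulrDl mul1r.
  have [l [rl lt sl]] := IH (r + d / 2) r'0 r't tT trN'.
  exists (r + d / 2 :: l); split => //=.
  rewrite rl andbT /fine; apply/andP; split; first lra.
  by apply: wd => //; lra.
exists (Num.truncn (T / (d / 2))).+1 => r t r0 rt tT; apply: key => //.
rewrite -ler_pdivrMr // ltW // (le_lt_trans _ (truncnS_gt _)) //.
by rewrite ler_pM2r ?invr_gt0 //; lra.
Qed.

End UniformControl.

Section ProductsOfScheme.
Context {R : realType} {V : normedModType R}.
Context {T : R} {omega : R -> R -> R} {alpha theta : R} {phi : R -> R -> V -> V}.
Hypotheses (om : control T omega) (al0 : 0 < alpha) (th1 : 1 < theta).
Hypothesis phiP : stable_scheme T omega alpha theta phi.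

Let control0 s t : 0 <= s -> s <= t -> t <= T -> 0 <= omega s t.
Proof. by case: om => w0 _ _ _; exact: w0. Qed.

Lemma fine_step h s l i : 0 <= s -> path (fine omega h) s l -> last s l <= T ->
  (i < size l)%N ->
  let g := nth 0 (s :: l) in
  [/\ 0 <= g i, g i <= g i.+1, g i.+1 <= T & omega (g i) (g i.+1) <= h].
Proof.
move=> s0 sl lT il g; have gr := path_grid s0 (fine_le sl) lT.
have [_ _ gle] := gr.
have [gi0 _] := grid_in gr (leq0n i) (ltnW il).
have [_ giT] := grid_in gr (leq0n i.+1) il.
by have /(pathP 0)/(_ i il) /andP[] := sl.
Qed.

(** Both the product and [y] make errors of at most [A * omega `^ theta] in each
    step. On a grid of fineness [h], these are at most [h `^ (theta - theta1)]
    relatively to [omega `^ theta1], for [theta1] between 1 and [theta]; so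
    [stability] applies with [rho] of this order. *)
Lemma product_close (A e : R) : 0 <= A -> 0 < e ->
  exists2 h0 : R, 0 < h0 &
  forall (h : R) (chi : R -> R -> V -> V) (y : R -> V) s l, 0 <= h -> h <= h0 ->
    0 <= s -> last s l <= T -> path (fine omega h) s l ->
    (forall u v a, 0 <= u -> u <= v -> v <= T ->
      `|chi v u a - phi v u a| <= A * omega u v `^ theta) ->
    (forall u v, u \in s :: l -> v \in s :: l -> u <= v -> omega u v <= h ->
      `|y v - phi v u (y u)| <= A * omega u v `^ theta) ->
    `|prod_along chi s l (y s) - y (last s l)| <= e.
Proof.
move=> A0 e0; pose theta1 := (1 + theta) / 2.
have th11 : 1 < theta1 by move: th1; rewrite /theta1; lra.
have th1th : theta1 <= theta by move: th1; rewrite /theta1; lra.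
have dth : 0 < theta - theta1 by move: th1; rewrite /theta1; lra.
have [K [k [K0 k0 k1 stab]]] := stability om al0 th1 phiP th11 th1th A0.
have KA0 : 0 <= K * (A + A) by rewrite mulr_ge0 // addr_ge0.
have [k' [k'0 _ k'e]] := powR_small KA0 dth e0.
exists (Num.min k k'); first by rewrite lt_min k0.
move=> h chi y s l h0; rewrite le_min => /andP[hk hk'] s0 lT sl chiA yA.
pose g := nth 0 (s :: l); pose Y i := prod_along chi s (take i l) (y s).
have gr := path_grid s0 (fine_le sl) lT.
have st i : (0 <= i)%N -> (i < size l)%N ->
    [/\ 0 <= g i, g i <= g i.+1, g i.+1 <= T & omega (g i) (g i.+1) <= h].
  by move=> _; exact: fine_step.
have Ystep i : (0 <= i)%N -> (i < size l)%N ->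
    `|Y i.+1 - phi (g i.+1) (g i) (Y i)| <= A * omega (g i) (g i.+1) `^ theta.
  move=> i0 il; have [? ? ? ?] := st i i0 il.
  by rewrite /Y prod_along_take // chiA.
have ystep i : (0 <= i)%N -> (i < size l)%N ->
    `|y (g i.+1) - phi (g i.+1) (g i) (y (g i))| <= A * omega (g i) (g i.+1) `^ theta.
  move=> i0 il; have [? ? ? ?] := st i i0 il.
  by apply: yA => //; apply: mem_nth => //=; rewrite ltnS ltnW.
pose rho := (A + A) * h `^ (theta - theta1).
have rho0 : 0 <= rho by rewrite mulr_ge0 ?powR_ge0 // addr_ge0.
have [| | | |] := stab g Y (fun i => y (g i)) rho 0%N (size l) (leq0n _) gr rho0.
- by move=> i i0 il; have [_ _ _ wh] := st i i0 il; exact: le_trans hk.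
- exact: Ystep.
- exact: ystep.
- move=> i i0 il; have [gi0 gi giT wh] := st i i0 il.
  rewrite (le_trans (ler_normB _ _)) // (le_trans (lerD (Ystep _ i0 il) (ystep _ i0 il))) //.
  rewrite -mulrDl /rho -mulrA ler_wpM2l ?addr_ge0 //.
  have w0 := control0 gi0 gi giT.
  have -> : omega (g i) (g i.+1) `^ theta =
      omega (g i) (g i.+1) `^ (theta - theta1) * omega (g i) (g i.+1) `^ theta1.
    by rewrite -powRD ?subrK // gt_eqF // (lt_trans ltr01).
  rewrite ler_wpM2r ?powR_ge0 //.
  by apply: ge0_ler_powR; rewrite ?nnegrE // ltW.
move=> H _; move: H; rewrite /Y take0 /= take_size subrr normr0 add0r.
rewrite /g -last_nth => /le_trans; apply.
by rewrite /rho mulrA k'e.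
Qed.

Lemma product_lipschitz : exists K k : R, [/\ 0 <= K, 0 < k & forall s l a b,
  0 <= s -> last s l <= T -> path (fine omega k) s l ->
  `|prod_along phi s l a - prod_along phi s l b| <= K * `|a - b| /\
  (omega s (last s l) <= k ->
   `|(prod_along phi s l a - prod_along phi s l b) - (a - b)| <= 1 / 2 * `|a - b|)].
Proof.
have [K [k [K0 k0 k1 stab]]] := stability om al0 th1 phiP th1 (lexx theta) (lexx 0).
exists K, k; split => // s l a b s0 lT sl.
have gr := path_grid s0 (fine_le sl) lT.
pose Y c i := prod_along phi s (take i l) c.
have Ys c i : (0 <= i)%N -> (i < size l)%N -> 
    `|Y c i.+1 - phi (nth 0 (s :: l) i.+1) (nth 0 (s :: l) i) (Y c i)| <=
    0 * omega (nth 0 (s :: l) i) (nth 0 (s :: l) i.+1) `^ theta.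
  by move=> _ il; rewrite /Y prod_along_take // subrr normr0 mul0r.
have [| | | |] := stab _ (Y a) (Y b) 0 0%N (size l) (leq0n _) gr (lexx 0).
- by move=> i _ il; have [_ _ _] := fine_step s0 sl lT il.
- exact: Ys.
- exact: Ys.
- move=> i i0 il; rewrite (le_trans (ler_normB _ _)) //.
  by rewrite (le_trans (lerD (Ys _ _ i0 il) (Ys _ _ i0 il))) // !mul0r addr0.
by rewrite /Y !take0 !take_size /= -last_nth addr0 mulr0 addr0.
Qed.

(** The sequence of the partial products is here a path indexed by times, so that
    it can be restricted to a coarser grid. A time that occurs several times in
    [big] is given its first index. *)
Lemma product_one_step : exists L k : R, [/\ 0 <= L, 0 < k &
  forall s big a u v, 0 <= s -> path <=%R s big -> last s big <= T ->
  let Y u := prod_along phi s (take (index u (s :: big)) big) a in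
  u \in s :: big -> v \in s :: big -> u <= v -> omega u v <= k ->
  `|Y v - phi v u (Y u)| <= L * omega u v `^ theta].
Proof.
have [L [k [L0 k0 k1 all]]] := one_step_to_all om al0 th1 phiP (lexx 0).
exists L, k; split => // s big a u v s0 sb bT Y ub vb uv wuv.
have gr := path_grid s0 sb bT.
pose i := index u (s :: big); pose j := index v (s :: big).
have iu : nth 0 (s :: big) i = u by exact: nth_index.
have jv : nth 0 (s :: big) j = v by exact: nth_index.
have ib : (i <= size big)%N by rewrite -ltnS -[(size big).+1]/(size (s :: big)) index_mem.
have jb : (j <= size big)%N by rewrite -ltnS -[(size big).+1]/(size (s :: big)) index_mem.
have [ij|ji] := leqP i j; last first.
  have vu : v <= u by rewrite -iu -jv; apply: path_nth_le => //; exact: ltnW.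
  have uvE : u = v by apply/eqP; rewrite eq_le uv.
  by move: ji; rewrite /i /j uvE ltnn.
have := all (nth 0 (s :: big)) (fun i => prod_along phi s (take i big) a) i j ij.
rewrite iu jv; apply => //; first exact: grid_sub gr (leq0n i) ij jb.
move=> m im mj; rewrite prod_along_take ?subrr ?normr0 ?mul0r //.
exact: leq_trans mj jb.
Qed.

(** The product along the common refinement of two grids is, at the points of
    each of them, an approximate solution by [product_one_step]; so
    [product_close] compares it with the products along both. *)
Lemma product_cauchy (e : R) : 0 < e -> exists2 h : R, 0 < h &
  forall s t l l' a, 0 <= s -> t <= T ->
    path (fine omega h) s l -> last s l = t ->
    path (fine omega h) s l' -> last s l' = t ->
    `|prod_along phi s l a - prod_along phi s l' a| <= e.
Proof.
move=> e0; have [L [k [L0 k0 one]]] := product_one_step.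
have e20 : 0 < e / 2 by rewrite divr_gt0.
have [h h0 close] := product_close L0 e20.
exists (Num.min h k); first by rewrite lt_min h0.
move=> s t l l' a s0 tT sl lt sl' lt'.
have hh : Num.min h k <= h by rewrite ge_min lexx.
have hk : Num.min h k <= k by rewrite ge_min lexx orbT.
pose big := sort <=%R (l ++ l').
have memb x : x \in s :: big = (x \in s :: l) || (x \in l').
  by rewrite !inE mem_sort mem_cat orbA.
have lein m x : path (fine omega (Num.min h k)) s m -> last s m = t -> x \in m ->
    s <= x /\ x <= t.
  move=> sm mt xm; rewrite -mt; apply: path_mem_le; first exact: fine_le sm.
  by rewrite inE xm orbT.
have sb : path <=%R s big.
  rewrite path_sortedE; last exact: le_trans.
  rewrite sort_sorted ?andbT; last exact: le_total.
  apply/allP => x; rewrite mem_sort mem_cat => /orP[] xl.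
    by have [] := lein _ _ sl lt xl.
  by have [] := lein _ _ sl' lt' xl.
have st : s <= t by rewrite -lt; apply: path_le_last; exact: fine_le sl.
have bT : last s big <= T.
  apply: le_trans tT; have : last s big \in s :: big by exact: mem_last.
  rewrite memb inE => /orP[/predU1P[->//|xl]|xl].
    by have [] := lein _ _ sl lt xl.
  by have [] := lein _ _ sl' lt' xl.
pose Y u := prod_along phi s (take (index u (s :: big)) big) a.
have Ys : Y s = a by rewrite /Y /= eqxx take0.
have key m : path (fine omega (Num.min h k)) s m -> last s m = t ->
    {subset s :: m <= s :: big} -> `|prod_along phi s m a - Y t| <= e / 2.
  move=> sm mt sub; rewrite -{1}Ys -mt; apply: (close (Num.min h k)) => //.
  - by rewrite le_min !ltW.
  - by rewrite mt.
  - by move=> u v b u0 uv vT; rewrite subrr normr0 mulr_ge0 ?powR_ge0.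
  - move=> u v um vm uv wh; apply: one => //; [exact: sub|exact: sub|].
    exact: le_trans hk.
have := key l sl lt; have := key l' sl' lt'.
have sub1 : {subset s :: l <= s :: big} by move=> x xl; rewrite memb xl.
have sub2 : {subset s :: l' <= s :: big}.
  by move=> x; rewrite memb !inE => /orP[->//|->]; rewrite !orbT.
move=> /(_ sub2) k2 /(_ sub1) k1.
have := ler_distD (Y t) (prod_along phi s l a) (prod_along phi s l' a).
rewrite (distrC (Y t)); lra.
Qed.

End ProductsOfScheme.

(** * The limit of the products *)

Section LimitOfProducts.
Context {R : realType} {V : completeNormedModType R}.
Context {T : R} {omega : R -> R -> R} {alpha theta : R} {phi : R -> R -> V -> V}.
Hypotheses (om : control T omega) (al0 : 0 < alpha) (th1 : 1 < theta).
Hypothesis phiP : stable_scheme T omega alpha theta phi.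

(** [h] depends neither on the interval nor on the starting point. *)
Definition product_limit (psi : R -> R -> V -> V) : Prop :=
  forall e : R, 0 < e -> exists2 h : R, 0 < h & forall r t l a,
    0 <= r -> t <= T -> path (fine omega h) r l -> last r l = t ->
    `|prod_along phi r l a - psi t r a| <= e.

(** [v] is the limit along a sequence of finer and finer grids. Stating the
    conclusion through the Cauchy moduli keeps it uniform in [r], [t] and [a]. *)
Lemma product_cvg_point r t a : 0 <= r -> r <= t -> t <= T ->
  exists v : V, forall e h : R, 0 < h ->
  (forall l l', path (fine omega h) r l -> last r l = t ->
     path (fine omega h) r l' -> last r l' = t ->
     `|prod_along phi r l a - prod_along phi r l' a| <= e) ->
  forall l, path (fine omega h) r l -> last r l = t ->
    `|prod_along phi r l a - v| <= e.
Proof.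
move=> r0 rt tT.
have /choice[l lP] (n : nat) : exists l : seq R,
    path (fine omega n.+1%:R^-1) r l /\ last r l = t.
  have n0 : (0 : R) < n.+1%:R^-1 by rewrite invr_gt0 ltr0n.
  have [N gridN] := exists_fine_grid om n0.
  by have [l [? ? _]] := gridN r t r0 rt tT; exists l.
pose u n := prod_along phi r (l n) a.
have small (h : R) : 0 < h -> \forall n \near \oo, (n.+1%:R^-1 : R) <= h.
  move=> h0; have := near_infty_natSinv_lt (PosNum h0).
  by apply: filterS => n /= /ltW.
have ucvg : cvgn u.
  apply/cauchy_cvgP; apply: cauchy_exP => e e0.
  have e20 : 0 < e / 2 by rewrite divr_gt0.
  have [h h0 cauchy] := product_cauchy om al0 th1 phiP e20.
  have [m _ mh] := small h h0; exists (u m).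
  suff : \forall n \near \oo, ball (u m) e (u n) by [].
  near=> n; rewrite -ball_normE /=.
  have nh : (n.+1%:R^-1 : R) <= h by near: n; exact: small.
  have [ln lnt] := lP n; have [lm lmt] := lP m.
  apply: le_lt_trans (cauchy r t (l m) (l n) a r0 tT _ lmt _ lnt) _; last lra.
    by apply: fine_weaken lm; apply: mh => /=.
  exact: fine_weaken ln.
exists (limn u) => e h h0 he m rm mt; apply/ler_addgt0Pr => e' e'0.
have uc := ucvg; move/cvgrPdist_lt: uc => /(_ e' e'0) near_u.
near \oo => n.
have un : `|limn u - u n| < e' by near: n; exact: near_u.
have nh : (n.+1%:R^-1 : R) <= h by near: n; exact: small.
have [ln lnt] := lP n.
have := he m (l n) rm mt (fine_weaken nh ln) lnt.
have := ler_distD (u n) (prod_along phi r m a) (limn u).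
rewrite (distrC (u n)) /u; lra.
Unshelve. all: by end_near. Qed.

Lemma exists_product_limit : exists psi, product_limit psi.
Proof.
pose Q t r a (v : V) := forall e h : R, 0 < h ->
  (forall l l', path (fine omega h) r l -> last r l = t ->
     path (fine omega h) r l' -> last r l' = t ->
     `|prod_along phi r l a - prod_along phi r l' a| <= e) ->
  forall l, path (fine omega h) r l -> last r l = t ->
    `|prod_along phi r l a - v| <= e.
exists (fun t r a => get (Q t r a)) => e e0.
have [h h0 cauchy] := product_cauchy om al0 th1 phiP e0.
exists h => // r t l a r0 tT rl lt.
have rt : r <= t by rewrite -lt; apply: path_le_last; exact: fine_le rl.
have /getPex : exists v, Q t r a v by exact: product_cvg_point.
move=> /(_ e h h0); apply => // m m' rm mt rm' mt'; exact: cauchy mt'.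
Qed.

Context {psi : R -> R -> V -> V}.
Hypothesis psiP : product_limit psi.

Let approx (e k : R) r t a b : 0 < e -> 0 < k -> 0 <= r -> r <= t -> t <= T ->
  exists l, [/\ path (fine omega k) r l, last r l = t,
    `|prod_along phi r l a - psi t r a| <= e &
    `|prod_along phi r l b - psi t r b| <= e].
Proof.
move=> e0 k0 r0 rt tT; have [h h0 hP] := psiP e0.
have hk : 0 < Num.min h k by rewrite lt_min h0.
have [N gridN] := exists_fine_grid om hk.
have [l [rl lt _]] := gridN r t r0 rt tT; exists l.
have rlh : path (fine omega h) r l by apply: fine_weaken rl; rewrite ge_min lexx.
split => //; [|exact: hP|exact: hP].
by apply: fine_weaken rl; rewrite ge_min lexx orbT.
Qed.

Lemma limit_id r a : 0 <= r -> r <= T -> psi r r a = a.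
Proof.
move=> r0 rT; apply/eqP; rewrite -subr_eq0 -normr_le0.
apply/ler_addgt0Pr => e e0; rewrite add0r distrC.
have [h h0 hP] := psiP e0; exact: (hP r r [::] a r0 rT).
Qed.

Lemma limit_lipschitz : exists2 K : R, 0 <= K & forall r t a b,
  0 <= r -> r <= t -> t <= T -> `|psi t r b - psi t r a| <= K * `|b - a|.
Proof.
have [K [k [K0 k0 lip]]] := product_lipschitz om al0 th1 phiP.
exists K => // r t a b r0 rt tT; apply/ler_addgt0Pr => e e0.
have e20 : 0 < e / 2 by rewrite divr_gt0.
have [l [rl lt pa pb]] := approx a b e20 k0 r0 rt tT.
have lT : last r l <= T by rewrite lt.
have [h1 _] := lip r l b a r0 lT rl.
have -> : psi t r b - psi t r a = (psi t r b - prod_along phi r l b)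
   + (prod_along phi r l b - prod_along phi r l a)
   + (prod_along phi r l a - psi t r a) by abelian.
rewrite (le_trans (ler_normD _ _)) //.
rewrite (le_trans (lerD (ler_normD _ _) (lexx _))) //.
rewrite (distrC (psi t r b)); lra.
Qed.

Lemma limit_near_id : exists2 k : R, 0 < k & forall r t a b,
  0 <= r -> r <= t -> t <= T -> omega r t <= k ->
  `|(psi t r b - psi t r a) - (b - a)| <= 1 / 2 * `|b - a|.
Proof.
have [K [k [K0 k0 lip]]] := product_lipschitz om al0 th1 phiP.
exists k => // r t a b r0 rt tT wk; apply/ler_addgt0Pr => e e0.
have e20 : 0 < e / 2 by rewrite divr_gt0.
have [l [rl lt pa pb]] := approx a b e20 k0 r0 rt tT.
have lT : last r l <= T by rewrite lt.
have [_] := lip r l b a r0 lT rl; rewrite lt => /(_ wk) h1.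
have -> : psi t r b - psi t r a - (b - a) = (psi t r b - prod_along phi r l b)
   + (prod_along phi r l b - prod_along phi r l a - (b - a))
   + (prod_along phi r l a - psi t r a) by abelian.
rewrite (le_trans (ler_normD _ _)) //.
rewrite (le_trans (lerD (ler_normD _ _) (lexx _))) //.
rewrite (distrC (psi t r b)); lra.
Qed.

Lemma limit_comp r s t a : 0 <= r -> r <= s -> s <= t -> t <= T ->
  psi t s (psi s r a) = psi t r a.
Proof.
move=> r0 rs st tT; apply/eqP; rewrite -subr_eq0 -normr_le0.
apply/ler_addgt0Pr => e e0; rewrite add0r.
have [K K0 lip] := limit_lipschitz.
have e30 : 0 < e / (K + 2) by rewrite divr_gt0 // ltr_wpDl.
have [h h0 hP] := psiP e30.
have [N gridN] := exists_fine_grid om h0.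
have [l [rl ls _]] := gridN r s r0 rs (le_trans st tT).
have [l' [sl' lt' _]] := gridN s t (le_trans r0 rs) st tT.
have h1 := hP r s l a r0 (le_trans st tT) rl ls.
have h2 := hP s t l' (prod_along phi r l a) (le_trans r0 rs) tT sl' lt'.
have h3 : `|prod_along phi r (l ++ l') a - psi t r a| <= e / (K + 2).
  by apply: hP => //; [rewrite cat_path rl ls|rewrite last_cat ls].
rewrite prod_along_cat ls in h3.
have h4 := lip s t (prod_along phi r l a) (psi s r a) (le_trans r0 rs) st tT.
have -> : psi t s (psi s r a) - psi t r a =
  (psi t s (psi s r a) - psi t s (prod_along phi r l a)) +
  (psi t s (prod_along phi r l a) - prod_along phi s l' (prod_along phi r l a)) +
  (prod_along phi s l' (prod_along phi r l a) - psi t r a) by abelian.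
rewrite (le_trans (ler_normD _ _)) //.
rewrite (le_trans (lerD (ler_normD _ _) (lexx _))) //.
rewrite distrC in h1; rewrite distrC in h2.
have h5 := le_trans h4 (ler_wpM2l K0 h1).
apply: (le_trans (lerD (lerD h5 h2) h3)).
have -> : K * (e / (K + 2)) + e / (K + 2) + e / (K + 2) = e / (K + 2) * (K + 2).
  by ring.
by rewrite divfK // gt_eqF // ltr_wpDl.
Qed.

(** The limit of [one_step_to_all] for the exact sequences of the scheme. *)
Lemma limit_solution_local : exists L k : R, [/\ 0 <= L, 0 < k, k <= 1 &
  forall s t b, 0 <= s -> s <= t -> t <= T -> omega s t <= k ->
  `|psi t s b - phi t s b| <= L * omega s t `^ theta].
Proof.
have [L [k [L0 k0 k1 all]]] := one_step_to_all om al0 th1 phiP (lexx 0).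
exists L, k; split => // s t b s0 st tT wk; apply/ler_addgt0Pr => e e0.
have [l [sl lt pb _]] := approx b b e0 k0 s0 st tT.
have lT : last s l <= T by rewrite lt.
have gr := path_grid s0 (fine_le sl) lT.
have := all (nth 0 (s :: l)) (fun i => prod_along phi s (take i l) b) 0%N (size l)
  (leq0n _) gr.
rewrite -last_nth lt take_size take0 /= => /(_ wk) H.
have {}H : `|prod_along phi s l b - phi t s b| <= L * omega s t `^ theta.
  apply: H => i _ il; by rewrite prod_along_take // subrr normr0 mul0r.
have := ler_distD (prod_along phi s l b) (psi t s b) (phi t s b).
rewrite (distrC (psi t s b) (prod_along phi s l b)); lra.
Qed.

Lemma limit_bounded : exists2 B : R, 0 <= B & forall s t b,
  0 <= s -> s <= t -> t <= T -> `|psi t s b - b| <= B.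
Proof.
have [L [k [L0 k0 k1 sol]]] := limit_solution_local.
have [C' C'P] := scheme_bounded phiP; pose C := `|C'|.
have CP s t a : 0 <= s -> s <= t -> t <= T -> `|phi t s a - a| <= C.
  by move=> *; rewrite (le_trans (C'P _ _ _ _ _ _)) // ler_norm.
have [N gridN] := exists_fine_grid om k0.
have B0 : 0 <= L + C := addr_ge0 L0 (normr_ge0 _).
exists (N%:R * (L + C)); first by rewrite mulr_ge0.
have one s t b : 0 <= s -> s <= t -> t <= T -> omega s t <= k ->
    `|psi t s b - b| <= L + C.
  move=> s0 st tT wk.
  have -> : psi t s b - b = (psi t s b - phi t s b) + (phi t s b - b) by abelian.
  rewrite (le_trans (ler_normD _ _)) // lerD ?CP //.
  rewrite (le_trans (sol s t b s0 st tT wk)) // ler_piMr //.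
  have w0 : 0 <= omega s t by case: om => w0 _ _ _; exact: w0.
  apply: (@le_trans _ _ (1 `^ theta)); last by rewrite powR1.
  apply: ge0_ler_powR; rewrite ?nnegrE //; last exact: le_trans k1.
  by rewrite ltW // (lt_trans ltr01).
have many l : forall s b, 0 <= s -> last s l <= T -> path (fine omega k) s l ->
    `|psi (last s l) s b - b| <= (size l)%:R * (L + C).
  elim: l => [|u l IH] s b s0 /= lT.
    by rewrite limit_id // subrr normr0 mul0r.
  move=> /andP[/andP[su wk] ul].
  have u0 : 0 <= u by exact: le_trans su.
  have uT : u <= T by apply: le_trans lT; apply: path_le_last; exact: fine_le ul.
  have ull : u <= last u l by apply: path_le_last; exact: fine_le ul.
  rewrite -(limit_comp b s0 su ull lT).
  have -> : psi (last u l) u (psi u s b) - b =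
     (psi (last u l) u (psi u s b) - psi u s b) + (psi u s b - b) by abelian.
  rewrite (le_trans (ler_normD _ _)) // -natr1 mulrDl mul1r lerD //.
    exact: IH.
  exact: one.
move=> s t b s0 st tT; have [l [sl lt lN]] := gridN s t s0 st tT.
rewrite -lt; apply: le_trans (many l s b s0 _ sl) _; first by rewrite lt.
by rewrite ler_wpM2r // ler_nat.
Qed.

(** Where [omega s t] is not small, [omega s t `^ theta] is bounded from below,
    and the bounds on the displacements suffice. *)
Lemma limit_solution : exists2 L : R, 0 <= L & forall s t b,
  0 <= s -> s <= t -> t <= T -> `|psi t s b - phi t s b| <= L * omega s t `^ theta.
Proof.
have [L [k [L0 k0 k1 sol]]] := limit_solution_local.
have [B B0 bB] := limit_bounded.
have [C' C'P] := scheme_bounded phiP; pose C := `|C'|.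
have CP s t a : 0 <= s -> s <= t -> t <= T -> `|phi t s a - a| <= C.
  by move=> *; rewrite (le_trans (C'P _ _ _ _ _ _)) // ler_norm.
have kth : 0 < k `^ theta by exact: powR_gt0.
have BC0 : 0 <= B + C := addr_ge0 B0 (normr_ge0 _).
have D0 : 0 <= (B + C) / k `^ theta by rewrite divr_ge0 // ltW.
exists (L + (B + C) / k `^ theta); first by rewrite addr_ge0.
move=> s t b s0 st tT; have [wk|wk] := lerP (omega s t) k.
  rewrite (le_trans (sol s t b s0 st tT wk)) // ler_wpM2r ?powR_ge0 //.
  by rewrite lerDl.
have -> : psi t s b - phi t s b = (psi t s b - b) - (phi t s b - b) by abelian.
rewrite (le_trans (ler_normB _ _)) //.
rewrite (le_trans (lerD (bB s t b s0 st tT) (CP s t b s0 st tT))) //.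
apply: (@le_trans _ _ ((B + C) / k `^ theta * omega s t `^ theta)); last first.
  by rewrite ler_wpM2r ?powR_ge0 // lerDr.
rewrite -mulrA ler_peMr // mulrC ler_pdivlMr // mul1r.
apply: ge0_ler_powR; rewrite ?nnegrE ?(ltW k0) ?(ltW wk) //.
  by rewrite ltW // (lt_trans ltr01).
by rewrite (le_trans (ltW k0)) // ltW.
Qed.

(** The products of the scheme started at [y r] are close to [y] by
    [product_close], and converge to the orbit of [y r]. *)
Lemma limit_unique (y : R -> V) (r C : R) : 0 <= r ->
  (forall s t, r <= s -> s <= t -> t <= T ->
     `|y t - phi t s (y s)| <= C * omega s t `^ theta) ->
  forall t, r <= t -> t <= T -> y t = psi t r (y r).
Proof.
move=> r0 yC t rt tT; apply/eqP; rewrite -subr_eq0 -normr_le0 distrC.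
apply/ler_addgt0Pr => e e0; rewrite add0r.
have e20 : 0 < e / 2 by rewrite divr_gt0.
have [h h0 close] := product_close om al0 th1 phiP (normr_ge0 C) e20.
have [l [rl lt pa _]] := approx (y r) (y r) e20 h0 r0 rt tT.
have H : `|prod_along phi r l (y r) - y (last r l)| <= e / 2.
  apply: (close h) => //; [exact: ltW|by rewrite lt| |].
    by move=> *; rewrite subrr normr0 mulr_ge0 ?powR_ge0.
  move=> u v ul vl uv _.
  have [ru _] := path_mem_le (fine_le rl) ul.
  have [_ vT] := path_mem_le (fine_le rl) vl; rewrite lt in vT.
  rewrite (le_trans (yC u v ru uv (le_trans vT tT))) //.
  by rewrite ler_wpM2r ?powR_ge0 // ler_norm.
rewrite lt in H; have := ler_distD (prod_along phi r l (y r)) (psi t r (y r)) (y t).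
rewrite (distrC (psi t r (y r)) (prod_along phi r l (y r))); lra.
Qed.

(** By [limit_near_id], [psi t r - id] has the Lipschitz constant [1 / 2] when
    [omega r t] is small. Hence [a |-> c - (psi t r a - a)] is a contraction, and
    its fixed point is the preimage of [c]. *)
Lemma limit_bijective_local : exists2 k : R, 0 < k & forall r t,
  0 <= r -> r <= t -> t <= T -> omega r t <= k -> bijective (psi t r).
Proof.
have [k k0 near_id] := limit_near_id.
exists k => // r t r0 rt tT wk.
have lip a b := near_id r t a b r0 rt tT wk.
have inj : injective (psi t r).
  move=> b a ab; have := lip a b; rewrite ab subrr sub0r normrN => h.
  apply/eqP; rewrite -subr_eq0 -normr_le0; lra.
have surj c : exists a, psi t r a = c.
  pose F a := c - (psi t r a - a).
  have Ffun : {homo F : x / [set: V] x >-> [set: V] x} by [].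
  have ctr : is_contraction (mkfun Ffun).
    have q0 : (0 : R) <= 1 / 2 by lra.
    exists (NngNum q0); split => /=; first by lra.
    move=> [a b] _ /=.
    have -> : F a - F b = - ((psi t r a - psi t r b) - (a - b)).
      by rewrite /F; abelian.
    by rewrite normrN; exact: lip.
  have [|a _ aF] := banach_fixed_point ctr closedT; first by exists 0.
  exists a; have : a = c - (psi t r a - a) := aF.
  move=> /(congr1 (fun x => x + (psi t r a - a))).
  by rewrite subrK addrC subrK.
have [g gP] := choice surj.
by exists g => // a; apply: inj; rewrite gP.
Qed.

Lemma limit_bijective r t : 0 <= r -> r <= t -> t <= T -> bijective (psi t r).
Proof.
move=> r0 rt tT; have [k k0 loc] := limit_bijective_local.
have [N gridN] := exists_fine_grid om k0.
have [l [rl lt _]] := gridN r t r0 rt tT.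
rewrite -{}lt in tT *; elim: l r r0 rl tT {rt} => [|u l IH] r r0 /= rl lT.
  by exists id => a; rewrite limit_id.
move: rl => /andP[/andP[ru wk] ul].
have u0 : 0 <= u by exact: le_trans ru.
have ull : u <= last u l by apply: path_le_last; exact: fine_le ul.
have b1 := loc r u r0 ru (le_trans ull lT) wk.
apply: (eq_bij (bij_comp (IH u u0 ul lT) b1)) => a /=.
exact: limit_comp.
Qed.

Lemma limit_continuous (e : R) : 0 < e -> exists2 d : R, 0 < d & forall s t b,
  0 <= s -> s <= t -> t <= T -> t - s < d -> `|psi t s b - b| <= e.
Proof.
move=> e0; have e20 : 0 < e / 2 by rewrite divr_gt0.
have [L L0 sol] := limit_solution; have [C C0 inc] := scheme_increment phiP.
have th0 : 0 < theta by exact: lt_trans ltr01 th1.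
have [k1 [k10 k11 k1e]] := powR_small L0 th0 e20.
have [k2 [k20 _ k2e]] := powR_small C0 al0 e20.
have k120 : 0 < Num.min k1 k2 by rewrite lt_min k10.
have [d d0 wd] := control_uniform om k120.
exists d => // s t b s0 st tT ts.
have := wd s t s0 st tT ts; rewrite le_min => /andP[w1 w2].
have w0 : 0 <= omega s t by case: om => w0 _ _ _; exact: w0.
have := sol s t b s0 st tT; have := inc s t b s0 st tT (le_trans w1 k11).
have := k1e _ w0 w1; have := k2e _ w0 w2.
have := ler_distD (phi t s b) (psi t s b) b; lra.
Qed.

End LimitOfProducts.

(** * Partitions of small mesh *)

Section Partitions.
Context {R : realType}.
Implicit Types (d s t x : R) (l pi : seq R).

Definition within_step d : rel R := fun u v => (u <= v) && (v - u < d).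

Lemma itv_partition_step T d pi : itv_partition 0 T pi -> mesh pi < d ->
  path (within_step d) 0 pi.
Proof.
move=> [p0 _] md; apply/(pathP 0) => i ip; apply/andP; split.
  by have /(pathP 0)/(_ i ip) /ltW := p0.
apply: le_lt_trans md; rewrite /mesh.
exact: (le_bigmax 0 (fun i : 'I_(size pi) => pi`_i - (0 :: pi)`_i) (Ordinal ip)).
Qed.

(** Here [x] is a point that precedes [s]; without it, nothing would bound the
    distance from [s] to the first point of the partition after [s]. *)
Lemma filter_step d x s t l : 0 < d -> path (within_step d) x l ->
  x <= s -> s <= t -> t <= last x l ->
  path (within_step d) s (rcons [seq u <- l | s <= u <= t] t).
Proof.
move=> d0; elim: l x s => [|y l IH] x s /=.
  move=> _ xs st tx; have -> : s = t by apply/eqP; rewrite eq_le st (le_trans tx).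
  by rewrite /within_step lexx subrr d0.
move=> /andP[/andP[xy yx] yl] xs st tl.
have ly u : u \in l -> y <= u.
  move=> ul; have : path <=%R y l by apply: sub_path yl => v w /andP[].
  by rewrite path_sortedE; [case/andP => /allP/(_ u ul)|exact: le_trans].
have [sy|ys] := lerP s y; last by apply: (IH y) => //; exact: ltW.
have [yt|ty] := lerP y t => /=.
  rewrite {1}/within_step sy /= (le_lt_trans _ yx) ?lerD2l ?lerN2 //=.
  have -> : [seq u <- l | s <= u <= t] = [seq u <- l | y <= u <= t].
    by apply: eq_in_filter => u /ly yu; rewrite yu (le_trans sy yu).
  exact: (IH y).
have -> : [seq u <- l | s <= u <= t] = [::].
  apply/eqP; rewrite -[_ == _]negbK -has_filter; apply/hasPn => u /ly yu.
  by rewrite negb_and -!ltNge (lt_le_trans ty yu) orbT.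
rewrite /= andbT /within_step st /=; lra.
Qed.

Lemma exists_partition T d : 0 < T -> 0 < d ->
  exists2 pi, itv_partition 0 T pi & mesh pi < d.
Proof.
move=> T0 d0; pose N := Num.truncn (T / d).
pose F (i : nat) : R := i%:R * (T / N.+1%:R).
have N0 : (0 : R) < N.+1%:R by rewrite ltr0n.
have TN0 : 0 < T / N.+1%:R by rewrite divr_gt0.
have TNd : T / N.+1%:R < d.
  by rewrite ltr_pdivrMr // mulrC -ltr_pdivrMr //; exact: truncnS_gt.
pose pi := mkseq (fun i => F i.+1) N.+1.
have nthF i : (i <= N.+1)%N -> (0 :: pi)`_i = F i.
  case: i => [|i] iN /=; first by rewrite /F mul0r.
  by rewrite nth_mkseq.
have step i : F i.+1 - F i = T / N.+1%:R.
  by rewrite /F -natr1 mulrDl mul1r addrC addKr.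
exists pi.
  split.
    apply/(pathP 0) => i; rewrite size_mkseq => iN.
    rewrite nthF ?(ltnW iN) // nth_mkseq // -subr_gt0 step //.
  rewrite (last_nth 0) size_mkseq nthF // /F mulrC divfK // gt_eqF //.
rewrite /mesh; apply: bigmax_lt => // i _.
have iN : (i < N.+1)%N by rewrite (leq_trans (ltn_ord i)) // size_mkseq.
by rewrite nthF ?(ltnW iN) // nth_mkseq // step.
Qed.

Context {T : R} {omega : R -> R -> R}.
Hypothesis om : control T omega.

Lemma partition_fine (h : R) : 0 < h -> exists2 d : R, 0 < d &
  forall pi s t, itv_partition 0 T pi -> mesh pi < d ->
    0 <= s -> s <= t -> t <= T ->
    path (fine omega h) s (rcons [seq u <- 0 :: pi | s <= u <= t] t).
Proof.
move=> h0; have [d d0 wd] := control_uniform om h0; exists d => // pi s t piP md s0 st tT.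
have step0 : path (within_step d) 0 (0 :: pi).
  rewrite /= {1}/within_step lexx subrr d0 /=.
  exact: itv_partition_step piP md.
have [_ /eqP lastT] := piP.
have tl : t <= last 0 (0 :: pi) by rewrite /= lastT.
have := filter_step d0 step0 s0 st tl.
apply: (@sub_in_path _ (fun u => (0 <= u) && (u <= T))).
  move=> u v /andP[u0 uT] /andP[v0 vT] /andP[uv vu].
  by rewrite /fine uv wd.
set l := [seq u <- _ | _].
have all_l : all (fun u => (0 <= u) && (u <= T)) l.
  apply/allP => u; rewrite mem_filter => /andP[/andP[su ut] _].
  by rewrite (le_trans s0 su) (le_trans ut tT).
by rewrite /= s0 (le_trans st tT) all_rcons tT (le_trans s0 st) all_l.
Qed.

End Partitions.

(** * The flow and the manifold of solutions *)

Section FlowOfLimit.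
Context {R : realType} {V : completeNormedModType R}.
Context {T : R} {omega : R -> R -> R} {alpha theta : R} {phi : R -> R -> V -> V}.
Hypotheses (om : control T omega) (al0 : 0 < alpha) (th1 : 1 < theta).
Hypothesis phiP : stable_scheme T omega alpha theta phi.
Context {Psi : R -> R -> V -> V}.
Hypothesis PsiP : product_limit (T := T) (omega := omega) (phi := phi) Psi.

Definition two_sided (t s : R) (a : V) : V :=
  if s <= t then Psi t s a else get [set b | Psi s t b = a].

Let forwardE s t a : s <= t -> two_sided t s a = Psi t s a.
Proof. by rewrite /two_sided => ->. Qed.

Lemma two_sided_inverse s t : 0 <= s -> s <= t -> t <= T ->
  cancel (two_sided t s) (two_sided s t) /\ cancel (two_sided s t) (two_sided t s).
Proof.
move=> s0 st tT; have [ts|ts] := lerP t s.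
  have -> : t = s by apply/eqP; rewrite eq_le ts.
  have sT : s <= T by exact: le_trans tT.
  have idE a : two_sided s s a = a by rewrite forwardE // (limit_id PsiP).
  by split=> a; rewrite !idE.
have bij := limit_bijective om al0 th1 phiP PsiP s0 st tT.
have backE a : two_sided s t a = get [set b | Psi t s b = a].
  by rewrite /two_sided leNgt ts.
have PsiK a : Psi t s (two_sided s t a) = a.
  rewrite backE; have [g _ gK] := bij.
  by have /getPex : exists b, [set b | Psi t s b = a] b by exists (g a); exact: gK.
split=> a; rewrite (forwardE _ st) // .
by apply: (bij_inj bij); rewrite PsiK.
Qed.

(** For decreasing times the flow relation follows from the one for increasing
    times by inversion. *)
Lemma two_sided_flow : flow T two_sided.
Proof.
have comp r s t a : 0 <= r -> r <= s -> s <= t -> t <= T ->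
    two_sided t s (two_sided s r a) = two_sided t r a.
  move=> r0 rs st tT; rewrite !forwardE //; last exact: le_trans st.
  exact: (limit_comp om al0 th1 phiP PsiP).
split.
- by move=> t a /andP[t0 tT]; rewrite forwardE // (limit_id PsiP).
- exact: two_sided_inverse.
move=> r s t a /andP[r0 rT] /andP[s0 sT] /andP[t0 tT] /orP[/andP[rs st]|/andP[ts sr]].
  exact: comp.
have tr : t <= r by exact: le_trans sr.
have [Ktr Krt] := two_sided_inverse t0 tr rT.
have [Kts Kst] := two_sided_inverse t0 ts sT.
have [Ksr Krs] := two_sided_inverse s0 sr rT.
apply: (can_inj Ktr); rewrite Krt -(comp t s r) //.
by rewrite Kst Krs.
Qed.

(** The orbits of [Psi] are solutions, hence [product_close] applies to them and
    to the products of [chi]. *)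
Lemma product_cvg_same_galaxy (chi : R -> R -> V -> V) (C : R) :
  (forall s t a, 0 <= s -> s <= t -> t <= T ->
     `|chi t s a - phi t s a| <= C * omega s t `^ theta) ->
  product_cvg T chi two_sided.
Proof.
move=> chiC s t a s0 st tT e e0.
have [L L0 sol] := limit_solution om al0 th1 phiP PsiP.
have e20 : 0 < e / 2 by rewrite divr_gt0.
have A0 : 0 <= `|C| + L by rewrite addr_ge0.
have [h h0 close] := product_close om al0 th1 phiP A0 e20.
have [d d0 fine_d] := partition_fine om h0.
exists d => // pi piP md; rewrite /iterated_product chain_prod_along forwardE //.
have sl := fine_d pi s t piP md s0 st tT.
set l := rcons _ t in sl *.
have lt : last s l = t by rewrite last_rcons.
have /= := close h chi (fun u => Psi u s a) s l (ltW h0) (lexx h) s0.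
rewrite lt (limit_id PsiP) ?(le_trans st) // => /(_ tT sl) H.
apply: le_lt_trans (H _ _) _; last lra.
  move=> u v b u0 uv vT; rewrite (le_trans (chiC u v b u0 uv vT)) //.
  rewrite ler_wpM2r ?powR_ge0 //; have := ler_norm C; lra.
move=> u v ul vl uv _.
have [su _] := path_mem_le (fine_le sl) ul.
have [_ vt] := path_mem_le (fine_le sl) vl; rewrite lt in vt.
rewrite -(limit_comp om al0 th1 phiP PsiP a s0 su uv (le_trans vt tT)).
rewrite (le_trans (sol u v _ (le_trans s0 su) uv (le_trans vt tT))) //.
by rewrite ler_wpM2r ?powR_ge0 // lerDr.
Qed.

Lemma limit_path_continuous r a : 0 <= r -> r <= T ->
  {within `[r, T], continuous (fun t => Psi t r a)}.
Proof.
move=> r0 rT; apply/subspace_continuousP => x; rewrite /= in_itv /= => /andP[rx xT].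
apply/cvgrPdist_le => e e0.
have [d d0 cont] := limit_continuous om al0 th1 phiP PsiP e0.
have step s t : r <= s -> s <= t -> t <= T -> t - s < d ->
    `|Psi t r a - Psi s r a| <= e.
  move=> rs st tT ts; rewrite -(limit_comp om al0 th1 phiP PsiP a r0 rs st tT).
  by apply: cont => //; exact: le_trans rs.
have near_d : \forall t \near nbhs x, `|x - t| < d.
  by have := nbhsx_ballx x d d0; rewrite -ball_normE.
suff : \forall t \near nbhs x, `[r, T]%classic t -> `|Psi x r a - Psi t r a| <= e by [].
apply: filterS near_d => t xt.
rewrite /= in_itv /= => /andP[rt tT].
have [le_xt|/ltW le_tx] := lerP x t.
  rewrite distrC; apply: step => //.
  by rewrite -[t - x]ger0_norm ?subr_ge0 // distrC.
by apply: step => //; rewrite -[x - t]ger0_norm ?subr_ge0.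
Qed.

End FlowOfLimit.

Unset Implicit Arguments.

Theorem corollary4 (R : realType) (U V : completeNormedModType R)
    (W : normedModType R) (tens : U -> U -> W)
    (T p gamma : R) (omega : R -> R -> R)
    (x1 : R -> R -> U) (x2 : R -> R -> W) (f : V -> clin U V) :
  0 < T -> 2 <= p -> p < 3 -> 0 < gamma -> gamma <= 1 -> p < 2 + gamma ->
  tensor_square tens ->
  control T omega ->
  rough_path tens T p omega x1 x2 ->
  Cb 2 gamma f ->
  let varpi : R -> R := fun tau => tau `^ ((2 + gamma) / p) in
  let phi : R -> R -> V -> V := rough_step tens x1 x2 f in
  (exists psi : R -> R -> V -> V,
    [/\ lipschitz_flow T psi /\ product_cvg T phi psi,
        (forall psi' : R -> R -> V -> V,
          lipschitz_flow T psi' -> product_cvg T phi psi' ->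
          forall (s t : R) (a : V), 0 <= s <= T -> 0 <= t <= T ->
            psi' t s a = psi t s a) &
        (forall chi : R -> R -> V -> V,
          almost_flow T omega varpi gamma chi ->
          same_galaxy T omega varpi chi phi ->
          product_cvg T chi psi)]) /\
  (exists y : R -> V -> R -> V,
    [/\ solution_manifold T omega varpi phi y,
        lipschitz_manifold T y &
        (forall y' : R -> V -> R -> V,
          solution_manifold T omega varpi phi y' ->
          forall (r : R) (a : V) (t : R), 0 <= r -> r <= t -> t <= T ->
            y' r a t = y r a t)]).
Proof.
move=> T0 p2 _ g0 g1 pg tensP om xP fC varpi phi.
have p0 : 0 < p by exact: lt_le_trans p2.
have al0 : 0 < 1 / p by rewrite divr_gt0.
have th1 : 1 < (2 + gamma) / p by rewrite ltr_pdivlMr // mul1r.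
have phiP := rough_step_stable p2 g0 g1 tensP om xP fC.
have [Psi PsiP] := exists_product_limit om al0 th1 phiP.
have [K K0 lip] := limit_lipschitz om al0 th1 phiP PsiP.
have [L L0 sol] := limit_solution om al0 th1 phiP PsiP.
have flowP := two_sided_flow om al0 th1 phiP PsiP.
have forwardE s t a : s <= t -> two_sided (Psi := Psi) t s a = Psi t s a.
  by rewrite /two_sided => ->.
have phi_cvg : product_cvg T phi (two_sided (Psi := Psi)).
  apply: (product_cvg_same_galaxy om al0 th1 phiP PsiP (C := 0)) => s t a *.
  by rewrite subrr normr0 mul0r.
split.
  exists (two_sided (Psi := Psi)); split.
  - split => //; split => //; exists K => s t a b s0 st tT.
    by rewrite !forwardE //; exact: lip.
  - move=> psi' [flow' _] cvg'.
    (* Two limits of the same products, along partitions of small mesh. *)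
    have forward s t a : 0 <= s -> s <= t -> t <= T ->
        psi' t s a = two_sided (Psi := Psi) t s a.
      move=> s0 st tT; apply/eqP; rewrite -subr_eq0 -normr_le0.
      apply/ler_addgt0Pr => e e0; rewrite add0r.
      have e20 : 0 < e / 2 by rewrite divr_gt0.
      have [d d0 H] := cvg' s t a s0 st tT _ e20.
      have [d' d'0 H'] := phi_cvg s t a s0 st tT _ e20.
      have dd : 0 < Num.min d d' by rewrite lt_min d0.
      have [pi piP] := exists_partition T0 dd; rewrite lt_min => /andP[md md'].
      have := H pi piP md; have := H' pi piP md'.
      have := ler_distD (iterated_product phi pi t s a) (psi' t s a)
        (two_sided (Psi := Psi) t s a).
      rewrite (distrC (psi' t s a) (iterated_product phi pi t s a)); lra.
    move=> s t a /andP[s0 sT] /andP[t0 tT]; have [st|/ltW ts] := lerP s t.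
      exact: forward.
    have [_ K1] := flow_inv flowP t0 ts sT.
    have [K2 _] := flow_inv flow' t0 ts sT.
    by rewrite -{1}(K1 a) -forward // K2.
  move=> chi _ [C chiC]; exact: (product_cvg_same_galaxy om al0 th1 phiP PsiP chiC).
exists (fun r a t => Psi t r a); split.
- move=> r a /andP[r0 rT]; split; first exact: (limit_id PsiP).
  exists L => s t rs st tT.
  rewrite -(limit_comp om al0 th1 phiP PsiP a r0 rs st tT).
  by apply: sol => //; exact: le_trans rs.
- split; last by exists K => r a b t r0 rt tT; exact: lip.
  by move=> r a /andP[r0 rT]; exact: (limit_path_continuous om al0 th1 phiP PsiP).
move=> y' y'P r a t r0 rt tT.
have rT : 0 <= r <= T by rewrite r0 (le_trans rt tT).
have [y'r [C y'C]] := y'P r a rT.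
by rewrite (limit_unique om al0 th1 phiP PsiP r0 y'C rt tT) y'r.
Qed.
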